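(* Let $n>1$, let $X$ be a vector space, let $(X^{n-1},|\!|\!|\cdot|\!|\!|)$ be a normed space and $(X^n,|\!|\!|\cdot|\!|\!|_+)$ a Banach space. Let $\Omega_1,\ldots,\Omega_n$ be nonempty subsets of $X$ and assume that $\widehat\Omega:=\Omega_1\times\ldots\times\Omega_n$ is closed in $(X^n,|\!|\!|\cdot|\!|\!|_+)$. Let $\widehat\omega:=(\omega_1,\ldots,\omega_n)\in\widehat\Omega$, $\varepsilon>0$ and $\delta>0$. Suppose that $\bigcap_{i=1}^n\Omega_i=\emptyset$ and $$|\!|\!|(\omega_1-\omega_n,\ldots,\omega_{n-1}-\omega_n)|\!|\!|<\inf_{u_i\in\Omega_i\ (i=1,\ldots,n)}|\!|\!|(u_1-u_n,\ldots,u_{n-1}-u_n)|\!|\!|+\varepsilon.$$ Then the following assertions hold. (i) There exist $\hat x:=(x_1,\ldots,x_n)\in\widehat\Omega\cap B_\delta(\widehat\omega)$ and $\hat x^*:=(x_1^*,\ldots,x_n^* )\in(X^* )^n$ such that $$\sum_{i=1}^n x_i^*=0,\qquad |\!|\!|(x_1^*,\ldots,x_{n-1}^* )|\!|\!|=1,$$ $$d\big(\hat x^*,N^C_{\widehat\Omega}(\hat x)\big)<\frac{\varepsilon}{\delta},\qquad \sum_{i=1}^{n-1}\langle x_i^*,x_n-x_i\rangle=|\!|\!|(x_n-x_1,\ldots,x_n-x_{n-1})|\!|\!|.$$ (ii) If $(X^n,|\!|\!|\cdot|\!|\!|_+)$ is Asplund, and there is a $\kappa>0$ such that $$\max\big\{|\!|\!|(u_1,\ldots,u_{n-1})|\!|\!|,\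 |\!|\!|(u_n,\ldots,u_n)_{n-1}|\!|\!|\big\}\le\kappa|\!|\!|(u_1,\ldots,u_n)|\!|\!|_+\quad\text{for all }u_1,\ldots,u_n\in X,$$ then, for any $\tau\in(0,1)$, there exist $\hat x:=(x_1,\ldots,x_n)\in\widehat\Omega\cap B_\delta(\widehat\omega)$ and $\hat x^*:=(x_1^*,\ldots,x_n^* )\in(X^* )^n$ such that $$\sum_{i=1}^n x_i^*=0,\qquad |\!|\!|(x_1^*,\ldots,x_{n-1}^* )|\!|\!|=1,$$ $$d\big(\hat x^*,N^F_{\widehat\Omega}(\hat x)\big)<\frac{\varepsilon}{\delta},\qquad \sum_{i=1}^{n-1}\langle x_i^*,x_n-x_i\rangle>\tau|\!|\!|(x_n-x_1,\ldots,x_n-x_{n-1})|\!|\!|.$$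
   Context: $(u,\ldots,u)_{n-1}$ means the element $(u,\ldots,u)\in X^{n-1}$. $B_\delta(\widehat\omega)$ is the open ball in $(X^n,|\!|\!|\cdot|\!|\!|_+)$ with centre $\widehat\omega$ and radius $\delta$. Duality. $X^*$ denotes the dual of $X$, a linear space of linear functionals on $X$. The continuous duals of $(X^{n-1},|\!|\!|\cdot|\!|\!|)$ and $(X^n,|\!|\!|\cdot|\!|\!|_+)$ are identified with $(X^* )^{n-1}$ and $(X^* )^n$, respectively, a tuple acting by $\langle(x_1^*,\ldots,x_m^* ),(u_1,\ldots,u_m)\rangle=\sum_{i=1}^m\langle x_i^*,u_i\rangle$. The corresponding dual norms are denoted by the same symbols: $|\!|\!|(x_1^*,\ldots,x_{n-1}^* )|\!|\!|$ is the dual norm of $|\!|\!|\cdot|\!|\!|$, and $d(\hat x^*,N)$ is the distance from $\hat x^*$ to the set $N\subset(X^* )^n$ in the dual norm of $|\!|\!|\cdot|\!|\!|_+$. Normal cones. For a subset $\Omega$ of a normed space $(Y,\|\cdot\|)$ and $\bar y\in\Omega$, the Fréchet normal cone is $$N^F_\Omega(\bar y):=\Big\{y^*\in Y^*\ \Big|\ \limsup_{\Omega\ni y\to\bar y,\,y\ne\bar y}\frac{\langle y^*,y-\bar y\rangle}{\|y-\bar y\|}\le0\Big\},$$ the Clarke tangent cone $T^C_\Omega(\bar y)$ is the set of all $z\in Y$ such that for all $y_k\to\bar y$ with $y_k\in\Omega$ and all $t_k\downarrow0$ there exist $z_k\to z$ with $y_k+t_kz_k\in\Omega$ for all $k\in\mathbb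 N$, and the Clarke normal cone is $N^C_\Omega(\bar y):=\{y^*\in Y^*\mid\langle y^*,z\rangle\le0\text{ for all }z\in T^C_\Omega(\bar y)\}$. Here they are taken with $Y=(X^n,|\!|\!|\cdot|\!|\!|_+)$. A Banach space is Asplund if every continuous convex function on an open convex set is Fréchet differentiable on a dense subset of that set. *)

(* Defs.v *)
From HB Require Import structures.
From mathcomp Require Import all_boot all_order all_algebra.
From mathcomp Require Import all_classical all_reals all_analysis.

Set Implicit Arguments.
Unset Strict Implicit.
Unset Printing Implicit Defensive.

Import Order.TTheory GRing.Theory Num.Theory.
Import numFieldNormedType.Exports.

Local Open Scope classical_set_scope.
Local Open Scope ring_scope.

Record norm_on (R : realType) (V : lmodType R) := NormOn {
  norm_fun :> V -> R;
  norm_onD : forall x y, norm_fun (x + y) <= norm_fun x + norm_fun y;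
  norm_onZ : forall (a : R) x, norm_fun (a *: x) = `|a| * norm_fun x;
  norm_on0 : forall x, norm_fun x = 0 -> x = 0
}.

(* A copy of [V] carrying the norm [N], so that the topological notions of the
   library apply to the normed space (V, N) for an arbitrary norm. *)
Definition normed (R : realType) (V : lmodType R) (N : norm_on V) : Type := V.

HB.instance Definition _ (R : realType) (V : lmodType R) (N : norm_on V) :=
  GRing.Lmodule.copy (normed N) V.
HB.instance Definition _ (R : realType) (V : lmodType R) (N : norm_on V) :=
  @Lmodule_isNormed.Build R (normed N) N
    (@norm_onD R V N) (@norm_onZ R V N) (@norm_on0 R V N).

Section NormedSpace.
Context (R : realType) (Y : normedModType R).

Definition dual : set (Y -> R) := [set f : Y -> R | scalar f /\ continuous f].

(* [sup] is total on the reals; the set below is bounded when [f] is in the dual. *)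
Definition dual_norm (f : Y -> R) : R :=
  sup [set `|f y| | y in [set y : Y | `|y| <= 1]].

Definition dual_dist (f : Y -> R) (C : set (Y -> R)) : R :=
  inf [set dual_norm (f \- g) | g in C].

(* The field of the mixin [Uniform_isComplete], as a property. *)
Definition is_complete : Prop :=
  forall F : set_system Y, ProperFilter F -> cauchy F -> cvg F.

(* [f] is a total function, but only its values on the open set [U] matter. *)
Definition asplund : Prop :=
  forall (U : set Y) (f : Y -> R^o),
    open U -> convex_set U -> convex_function U f -> {in U, continuous f} ->
    U `<=` closure (U `&` [set y | differentiable f y]).

(* If [y] is isolated in [A], the upper limit is that along an improper filter,
   which is [-oo], so that the cone is the whole dual. *)
Definition frechet_normal_cone (A : set Y) (y : Y) : set (Y -> R) :=
  [set f : Y -> R | dual f /\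
    (limf_esup (fun z : Y => (f (z - y) / `|z - y|)%:E) (within A (y^'))
       <= 0)%E].

(* t_k -> 0 through positive values; asking in addition that t_k be monotone
   gives the same cone, by passing to subsequences. *)
Definition clarke_tangent_cone (A : set Y) (y : Y) : set Y :=
  [set z : Y | forall (y_ : nat -> Y) (t_ : nat -> R),
    y_ @ \oo --> y -> (forall k, A (y_ k)) ->
    (forall k, 0 < t_ k) -> t_ @ \oo --> 0 ->
    exists z_ : nat -> Y,
      z_ @ \oo --> z /\ forall k, A (y_ k + t_ k *: z_ k)].

Definition clarke_normal_cone (A : set Y) (y : Y) : set (Y -> R) :=
  [set f : Y -> R | dual f /\ forall z, clarke_tangent_cone A y z -> f z <= 0].

End NormedSpace.

Arguments dual {R} Y _.
Arguments dual_norm {R} Y f.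
Arguments dual_dist {R} Y f C.
Arguments is_complete {R} Y.
Arguments asplund {R} Y.
Arguments frechet_normal_cone {R} Y A y _.
Arguments clarke_tangent_cone {R} Y A y _.
Arguments clarke_normal_cone {R} Y A y _.

Section Tuples.
Context (R : realType) (X : lmodType R).

(* [D] stands for X^*, a linear space of linear functionals on X, which carries
   no topology of its own. *)
Definition functional_space (D : set (X -> R)) : Prop :=
  [/\ forall f, D f -> scalar f, D (cst 0) &
      forall (a : R) f g, D f -> D g -> D (fun x => a * f x + g x)].

Definition pairing (m : nat) (xs : 'I_m -> X -> R) (u : {ffun 'I_m -> X}) : R :=
  \sum_i xs i (u i).

(* The identification of the continuous dual of (X^m, N) with D^m: the
   continuous linear functionals are exactly those of the form [pairing xs] with
   all the [xs i] in D. *)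
Definition dual_is_power (m : nat) (N : norm_on {ffun 'I_m -> X})
    (D : set (X -> R)) : Prop :=
  dual (normed N) = @pairing m @` [set xs | forall i, D (xs i)].

Definition set_prod (m : nat) (A : 'I_m -> set X) : set {ffun 'I_m -> X} :=
  [set u | forall i, A i (u i)].

End Tuples.

(* With indices starting at 0, [last_idx] is the index of the last coordinate of
   X^n, and [init_idx] embeds the indices of X^(n-1) as the other ones. *)
Definition last_idx (n : nat) (n_gt1 : (1 < n)%N) : 'I_n :=
  Ordinal (etrans (ltn_predL n) (ltnW n_gt1)).

Definition init_idx (n : nat) (i : 'I_n.-1) : 'I_n := widen_ord (leq_pred n) i.

(* Main.v *)
Require Import Defs.
From HB Require Import structures.
From mathcomp Require Import all_boot all_order all_algebra.
From mathcomp Require Import all_classical all_reals all_analysis.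
From mathcomp Require Import ring lra.

Set Implicit Arguments.
Unset Strict Implicit.
Unset Printing Implicit Defensive.

Import Order.TTheory GRing.Theory Num.Theory.
Import numFieldNormedType.Exports.

Local Open Scope classical_set_scope.
Local Open Scope ring_scope.

(** Put [f u = N (u_1 - u_n, .., u_(n-1) - u_n)], a seminorm on [X^n].  It is
    continuous: being the supremum of the functionals [phi o A], with [A] the
    map of differences and [phi] in the dual unit ball of [N], it is bounded by
    the uniform boundedness principle ([differences_bounded]).  By [ekeland]
    there is a point [x1] of the product set [Om], close to [omega], that
    minimizes [f + c |. - x1|] over [Om] for some [c < eps / delta]; moreover
    [f x1 > 0], because the sets have no common point.

    The rest is an optimality condition at, or near, [x1]: linear functionals
    [l] and [psi] are wanted, [l] an (approximate) subgradient of [f] and [psi]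
    of norm about [c], such that [- (l + psi)] is normal to [Om].  Since [f] is
    a norm composed with [A], a subgradient of [f] factors through [A]; up to a
    sign and a normalization it is the tuple that the theorem asks for, and
    [psi] measures its distance to the normal cone
    ([functionals_of_subgradient]).

    For Clarke normals, [f x1 <= f (x1 + z) + c |z|] holds on the Clarke
    tangent cone, which is a convex cone, and one application of the
    Hahn-Banach theorem on the product of two copies of the space separates
    [f] from [c |.|] ([clarke_minimum], [subgradient_splitting]).

    For Fréchet normals the relevant tangent directions do not form a convex
    cone, and [f + c |. - x1|] has to be replaced by a function that is Fréchet
    differentiable at the minimizer.  This is possible along a subspace [Z] that
    is the closure of a countable set.
    - The restrictions to [Z] of the functionals have a countable dense family
      ([separable_dual]).  Otherwise there is a set of functionals that has no
      slices, defined by points of [Z], of small diameter.  A minimal sublinear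
      functional on the whole space whose restriction to [Z] dominates this set
      has a point of Fréchet differentiability, hence a small slice, and
      minimality brings this slice back to one of the set.
    - Given a countable dense family [F] and a Lipschitz convex function [G], a
      small multiple of the weighted sum of the squared distances to the [F n] is
      added to the convex conjugate of [G].  The conjugate of the sum is a convex
      function uniformly close to [G]; it is Fréchet differentiable along [Z]
      everywhere, because near-maximizers in its definition have almost the
      same distances to all the [F n], hence are close to each other
      ([smooth_approximation]).
    - Norms are smoothed in the same way.  Using them as gauges in
      [variational_principle] gives a smooth convex function whose minimum over
      the part of [Om] in [Z] is attained, and the derivative there, with
      opposite sign, is a Fréchet normal along [Z] ([fuzzy_on_subspace]).
    - The subspace is chosen so rich ([rich_set]) that the finite families of
      points of [Om] that would prevent this derivative from being corrected to
      a Fréchet normal in the whole space could be found inside [Z]; as there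
      are none there, the Hahn-Banach theorem yields [l] and [psi]
      ([asplund_fuzzy]). *)

(** * Convex functions and the Hahn-Banach theorem *)

Section HahnBanach.
Context (R : realType) (V : lmodType R).
Implicit Types (p q K l : V -> R) (C G : set (V * R)).

Definition sublinear p : Prop :=
  (forall x y, p (x + y) <= p x + p y) /\
  (forall t x, 0 < t -> p (t *: x) = t * p x).

Definition convexf K : Prop := forall x y t, 0 <= t -> t <= 1 ->
  K (t *: x + (1 - t) *: y) <= t * K x + (1 - t) * K y.

Lemma sublinearW p : (forall x y, p (x + y) <= p x + p y) ->
  (forall t x, 0 < t -> p (t *: x) <= t * p x) -> sublinear p.
Proof.
move=> pD pZ; split=> // t x t0; apply/eqP; rewrite eq_le pZ//=.
have := pZ t^-1 (t *: x); rewrite invr_gt0 scalerA mulVf ?gt_eqF// scale1r.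
by move=> /(_ t0); rewrite ler_pdivlMl.
Qed.

Lemma sublinear0 p : sublinear p -> p 0 = 0.
Proof.
move=> [_ /(_ 2 0)]; rewrite scaler0 => /(_ ltac:(lra)) h; lra.
Qed.

Lemma sublinear_geN p x : sublinear p -> - p (- x) <= p x.
Proof.
move=> ps; have := ps.1 x (- x); rewrite subrr sublinear0//; lra.
Qed.

Lemma sublinear_convexf p : sublinear p -> convexf p.
Proof.
move=> ps x y t t0 t1.
have aux (s : R) z : 0 <= s -> p (s *: z) = s * p z.
  rewrite le_eqVlt => /predU1P[<-|s0]; last exact: ps.2.
  by rewrite scale0r mul0r sublinear0.
apply: le_trans (ps.1 _ _) _; rewrite !aux ?subr_ge0//.
Qed.

Lemma convexf_translate K v b : convexf K -> convexf (fun y => K (v + y) + b).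
Proof.
move=> Kc x y t t0 t1.
have -> : v + (t *: x + (1 - t) *: y) = t *: (v + x) + (1 - t) *: (v + y).
  by rewrite !scalerDr addrACA -scalerDl subrKC scale1r.
by have := Kc (v + x) (v + y) t t0 t1; lra.
Qed.

Lemma scalarE l : scalar l -> [/\ l 0 = 0, forall x, l (- x) = - l x,
  forall x y, l (x + y) = l x + l y & forall a x, l (a *: x) = a * l x].
Proof.
move=> ls; have l0 : l 0 = 0.
  by have := ls (-1) 0 0; rewrite scaler0 addr0 => ?; lra.
have lZ a x : l (a *: x) = a * l x by have := ls a x 0; rewrite !addr0 l0 addr0.
split=> // [x|x y].
  by rewrite -scaleN1r lZ mulN1r.
by have := ls 1 x y; rewrite scale1r mul1r.
Qed.

Lemma inf_le1 (A : set R) x b : (forall y, A y -> b <= y) -> A x -> inf A <= x.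
Proof. by move=> Ab Ax; apply: ge_inf => //; exists b. Qed.

(** A chain of sublinear functionals is bounded below by [- p0 (- x)] at [x], so
    its pointwise infimum is again sublinear and Zorn's lemma applies.  Without
    constraints a minimal functional is linear; the constraints [C] serve for
    [separable_dual]. *)
Lemma minimal_sublinear p0 C : sublinear p0 ->
  (forall c, C c -> c.2 <= p0 c.1) ->
  exists p, [/\ sublinear p, forall x, p x <= p0 x,
    forall c, C c -> c.2 <= p c.1 &
    forall q, sublinear q -> (forall x, q x <= p x) ->
      (forall c, C c -> c.2 <= q c.1) -> forall x, p x <= q x].
Proof.
move=> p0s p0C.
pose P p := [/\ sublinear p, forall x, p x <= p0 x &
  forall c, C c -> c.2 <= p c.1].
pose T := {p | P p}.
have P0 : P p0 by [].
pose Rel (p q : T) := `[< forall x, sval q x <= sval p x >].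
have [|||[p [ps pp0 pC]] pmin] := @ZL_preorder T (exist _ p0 P0) Rel.
- by move=> t; apply/asboolP.
- move=> r s t /asboolP rs /asboolP st; apply/asboolP => x.
  exact: le_trans (st x) (rs x).
- move=> A Atot; have [[a0 Aa0]|A0] := pselect (A !=set0); last first.
    exists (exist _ p0 P0) => s As; exfalso; apply: A0; by exists s.
  pose g x := inf [set sval p x | p in A].
  have lb x y : [set sval p x | p in A] y -> - p0 (- x) <= y.
    move=> [[p [ps pp0 pC]] _ <-] /=; apply: le_trans (sublinear_geN x ps).
    by rewrite lerN2.
  have gle a x : A a -> g x <= sval a x.
    by move=> Aa; apply: (@inf_le1 _ _ (- p0 (- x))) => //; [exact: lb|exists a].
  have leg b x : (forall a, A a -> b <= sval a x) -> b <= g x.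
    move=> h; apply: lb_le_inf; first by exists (sval a0 x); exists a0.
    by move=> _ [a Aa <-]; exact: h.
  have Pg : P g.
    split.
    + apply: sublinearW => [x y|t x t0].
        rewrite -lerBlDl; apply: (leg) => b Ab.
        rewrite lerBlDl -lerBlDr; apply: (leg) => a Aa; rewrite lerBlDr.
        have [/asboolP ab|/asboolP ba] := Atot _ _ Aa Ab.
          apply: le_trans (gle _ _ Ab) _.
          case: (svalP b) => -[bD _] _ _.
          by apply: le_trans (bD _ _) _; rewrite lerD2r.
        apply: le_trans (gle _ _ Aa) _.
        case: (svalP a) => -[aD _] _ _.
        by apply: le_trans (aD _ _) _; rewrite lerD2l.
      rewrite -ler_pdivrMl//; apply: (leg) => a Aa; rewrite ler_pdivrMl//.
      case: (svalP a) => -[_ aZ] _ _.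
      by rewrite -aZ//; exact: gle.
    + by move=> x; apply: le_trans (gle a0 x Aa0) _; case: (svalP a0).
    + by move=> c Cc; apply: (leg) => a Aa; case: (svalP a) => _ _; exact.
  by exists (exist _ g Pg) => s As; apply/asboolP => x; exact: gle.
exists p; split=> // q qs qp qC x.
have Pq : P q by split=> // y; exact: le_trans (qp y) (pp0 y).
have := pmin (exist _ q Pq); rewrite /Rel /= => h.
have /h/asboolP : `[< forall x, q x <= p x >] by apply/asboolP.
exact.
Qed.

(** For fixed [y], [inf_(t >= 0) (p (x + t y) - t p y)] is sublinear in [x] and at
    most [p], so it equals [p]; with [t = 1] this says that [p] is superadditive. *)
Lemma minimal_sublinear_linear p : sublinear p ->
  (forall q, sublinear q -> (forall x, q x <= p x) -> forall x, p x <= q x) ->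
  scalar p.
Proof.
move=> ps pmin.
have pD x y : p (x + y) = p x + p y.
  apply/eqP; rewrite eq_le ps.1/= -lerBrDr.
  pose S x := [set p (x + t *: y) - t * p y | t in [set t | 0 <= t]].
  pose q x := inf (S x).
  have lb x' z : S x' z -> - p (- x') <= z.
    move=> [t /= t0 <-]; move: t0; rewrite le_eqVlt => /predU1P[<-|t0].
      by rewrite scale0r addr0 mul0r subr0; exact: sublinear_geN.
    by rewrite -ps.2//; have := ps.1 (x' + t *: y) (- x'); rewrite addrC addKr; lra.
  have qle x' t : 0 <= t -> q x' <= p (x' + t *: y) - t * p y.
    by move=> t0; apply: inf_le1; [exact: lb|exists t].
  have leq b x' : (forall t, 0 <= t -> b <= p (x' + t *: y) - t * p y) -> b <= q x'.
    move=> h; apply: lb_le_inf; first by exists (p (x' + 0 *: y) - 0 * p y); exists 0 => /=.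
    by move=> _ [t t0 <-]; exact: h.
  apply: le_trans (_ : q x <= _); last by have := qle x 1 ler01; rewrite scale1r mul1r.
  apply: pmin.
    apply: sublinearW => [u v|s u s0].
      rewrite -lerBlDl; apply: (leq) => b b0.
      rewrite lerBlDl -lerBlDr; apply: (leq) => a a0; rewrite lerBlDr.
      apply: le_trans (qle _ _ (addr_ge0 a0 b0)) _.
      have := ps.1 (u + a *: y) (v + b *: y).
      by rewrite addrACA -scalerDl => ?; lra.
    rewrite -ler_pdivrMl//; apply: (leq) => a a0; rewrite ler_pdivrMl//.
    have := qle (s *: u) (s * a) (mulr_ge0 (ltW s0) a0).
    by rewrite -scalerA -scalerDr ps.2//; lra.
  by move=> u; have := qle u 0 (lexx _); rewrite scale0r addr0 mul0r subr0.
have p0 := sublinear0 ps.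
have pN x : p (- x) = - p x by have := pD x (- x); rewrite subrr p0; lra.
move=> a x y; rewrite pD; congr (_ + _).
have [->|a0] := eqVneq a 0; first by rewrite scale0r mul0r.
have [a0'|a0'] := ltP 0 a; first exact: ps.2.
have na : 0 < - a by rewrite oppr_gt0 lt_neqAle a0.
by rewrite -[a]opprK scaleNr pN ps.2// !mulNr.
Qed.

(** [inf_(t > 0) K (t x) / t] is sublinear and at most [K], and it is finite since
    [0 <= K 0]. *)
Lemma convex_minorant K : convexf K -> 0 <= K 0 ->
  exists l, scalar l /\ forall x, l x <= K x.
Proof.
move=> Kc K0.
pose S x := [set K (t *: x) / t | t in [set t | 0 < t]].
pose k x := inf (S x).
have lb x z : S x z -> - K (- x) <= z.
  move=> [t /= t0 <-].
  have t1 : 0 < 1 + t by rewrite addr_gt0.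
  have h0 : 0 <= (1 + t)^-1 by rewrite invr_ge0 ltW.
  have h1 : (1 + t)^-1 <= 1 by rewrite invf_le1//; lra.
  have := Kc (t *: x) (- x) (1 + t)^-1 h0 h1.
  have -> : 1 - (1 + t)^-1 = t / (1 + t) by field; rewrite gt_eqF.
  rewrite scalerA scalerN [t / _]mulrC subrr => h.
  have : 0 <= (1 + t)^-1 * (K (t *: x) + t * K (- x)) by rewrite mulrDr; lra.
  rewrite pmulr_rge0 ?invr_gt0// => h2.
  by rewrite ler_pdivlMr//; lra.
have kle x t : 0 < t -> k x <= K (t *: x) / t.
  by move=> t0; apply: inf_le1; [exact: lb|exists t].
have lek b x : (forall t, 0 < t -> b <= K (t *: x) / t) -> b <= k x.
  move=> h; apply: lb_le_inf; first by exists (K (1 *: x) / 1); exists 1 => /=.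
  by move=> _ [t t0 <-]; exact: h.
have ks : sublinear k.
  apply: sublinearW => [u v|s u s0].
    rewrite -lerBlDl; apply: (lek) => b b0.
    rewrite lerBlDl -lerBlDr; apply: (lek) => a a0; rewrite lerBlDr.
    have ab : 0 < a + b by rewrite addr_gt0.
    have s0 : 0 < a * b / (a + b) by rewrite divr_gt0// mulr_gt0.
    apply: le_trans (kle _ _ s0) _.
    have h0 : 0 <= b / (a + b) by rewrite divr_ge0// ltW.
    have h1 : b / (a + b) <= 1 by rewrite ler_pdivrMr//; lra.
    have := Kc (a *: u) (b *: v) (b / (a + b)) h0 h1.
    have -> : 1 - b / (a + b) = a / (a + b) by field; rewrite gt_eqF.
    have -> : (b / (a + b)) *: (a *: u) + (a / (a + b)) *: (b *: v) =
        (a * b / (a + b)) *: (u + v).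
      by rewrite !scalerA scalerDr; congr (_ *: _ + _ *: _); ring.
    move=> h; rewrite ler_pdivrMr//; apply: le_trans h _.
    rewrite le_eqVlt; apply/orP; left; apply/eqP; field.
    by rewrite !gt_eqF.
  rewrite -ler_pdivrMl//; apply: (lek) => a a0; rewrite ler_pdivrMl//.
  have := kle (s *: u) (a / s) (divr_gt0 a0 s0).
  by rewrite scalerA divfK ?gt_eqF// invf_div; lra.
have [p [ps pk _ pmin]] := @minimal_sublinear k set0 ks ltac:(by []).
exists p; split.
  apply: minimal_sublinear_linear => // q qs qp x; exact: pmin.
move=> x; apply: le_trans (pk x) _.
by have := kle x 1 ltr01; rewrite scale1r divr1.
Qed.

Lemma subgradient K v : convexf K ->
  exists l, scalar l /\ forall y, l y <= K (v + y) - K v.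
Proof.
move=> Kc; apply: convex_minorant; first exact: convexf_translate.
by rewrite addr0 subrr.
Qed.

(** The convex function to which [convex_minorant] applies is
    [inf_((w, k) in G) (p (x + w) + k)].  The function [B] keeps this infimum
    finite; for a Lipschitz [p] it is a multiple of the norm. *)
Lemma sandwich p G B : convexf p -> G (0, 0) ->
  (forall c d, G c -> G d -> G (c + d)) ->
  (forall t c, 0 < t -> G c -> G (t *: c.1, t * c.2)) ->
  (forall x w, p w <= p (x + w) + B x) ->
  (forall c, G c -> 0 <= p c.1 + c.2) ->
  exists l, [/\ scalar l, forall x, l x <= p x &
     forall c, G c -> 0 <= l c.1 + c.2].
Proof.
move=> pc G0 GD GZ pB pG.
pose S x := [set p (x + c.1) + c.2 | c in G].
pose q x := inf (S x).
have lb x z : S x z -> - B x <= z.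
  by move=> [c /= Gc <-]; have := pB x c.1; have := pG c Gc; lra.
have qle x c : G c -> q x <= p (x + c.1) + c.2.
  by move=> Gc; apply: inf_le1; [exact: lb|exists c].
have leq b x : (forall c, G c -> b <= p (x + c.1) + c.2) -> b <= q x.
  move=> h; apply: lb_le_inf; first by exists (p (x + 0) + 0); exists (0, 0).
  by move=> _ [c Gc <-]; exact: h.
have [||l [ls lq]] := @convex_minorant q.
- move=> x y t t0 t1.
  move: t0; rewrite le_eqVlt => /predU1P[<-|t0].
    by rewrite !scale0r !mul0r !add0r subr0 scale1r mul1r.
  move: t1; rewrite le_eqVlt => /predU1P[->|t1].
    by rewrite subrr !scale0r !mul0r !addr0 scale1r mul1r.
  have t1' : 0 < 1 - t by rewrite subr_gt0.
  rewrite -lerBlDl -ler_pdivrMl//; apply: (leq) => d Gd; rewrite ler_pdivrMl//.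
  rewrite lerBlDl -lerBlDr -ler_pdivrMl//; apply: (leq) => c Gc.
  rewrite ler_pdivrMl// lerBlDr.
  apply: le_trans (qle _ _ (GD _ _ (GZ t _ t0 Gc) (GZ (1 - t) _ t1' Gd))) _.
  have /= := pc (x + c.1) (y + d.1) t (ltW t0) (ltW t1).
  by rewrite !scalerDr addrACA => ?; lra.
- by apply: (leq) => c Gc; rewrite add0r; exact: pG.
exists l; split=> // [x|c Gc].
  by apply: le_trans (lq x) _; have := qle x (0, 0) G0; rewrite !addr0.
have [l0 lN lD lZ] := scalarE ls.
rewrite leNgt; apply/negP => lneg.
(* A negative value would be scaled by [t]; this [t] makes it smaller than [- p 0]. *)
pose e := - (l c.1 + c.2).
have e0 : 0 < e by rewrite oppr_gt0.
pose t := (`|p 0| + 1) / e.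
have t0 : 0 < t by rewrite divr_gt0// ltr_wpDl.
have := le_trans (lq (- (t *: c.1))) (qle _ _ (GZ t _ t0 Gc)).
rewrite /= addNr lN lZ.
have te : t * e = `|p 0| + 1 by rewrite /t divfK ?gt_eqF.
have := ler_norm (p 0); rewrite /e in te; nra.
Qed.

End HahnBanach.

(** * A variational principle with prescribed gauges *)

Section GeometricBounds.
Context (R : realType).

Lemma geom_small (C eps : R) : 0 < eps -> exists k : nat, C * 2^-1 ^+ k < eps.
Proof.
move=> e0.
have : (fun k => C * 2^-1 ^+ k) @ \oo --> (C * 0 : R).
  apply: cvgM; first exact: cvg_cst.
  by apply: cvg_expr; rewrite ger0_norm ?invr_ge0//; lra.
rewrite mulr0 => /cvgrPdist_lt/(_ _ e0) [N _ /(_ N (leqnn _))] /=.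
rewrite sub0r normrN => h; exists N; exact: le_lt_trans (ler_norm _) h.
Qed.

Lemma le_geom (a b C : R) : (forall k : nat, a <= b + C * 2^-1 ^+ k) -> a <= b.
Proof.
move=> h; apply/ler_addgt0Pr => e e0.
have [k Ck] := geom_small C e0.
by apply: le_trans (h k) _; rewrite lerD2l ltW.
Qed.

Context (Y : normedModType R) (Y_complete : is_complete Y).

Lemma geom_cauchy_cvg (u : nat -> Y) (C : R) :
  (forall k m, (k <= m)%N -> `|u m - u k| <= C * 2^-1 ^+ k) ->
  exists2 v, u @ \oo --> v & forall k, `|v - u k| <= C * 2^-1 ^+ k.
Proof.
move=> uC.
have /cvg_ex[/= v uv] : cvg (u @ \oo).
  apply: Y_complete; apply: cauchy_exP => e e0.
  have [k Ck] := geom_small C e0.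
  exists (u k); exists k => // m /= km; rewrite -ball_normE /= distrC.
  exact: le_lt_trans (uC k m km) Ck.
exists v => // k; apply/ler_addgt0Pr => e e0.
move/cvgrPdist_lt : uv => /(_ _ e0) [N _ /(_ (maxn N k) (leq_maxl _ _))] /= h.
rewrite -(subrKA (u (maxn N k))) addrC; apply: le_trans (ler_normD _ _) _.
by rewrite lerD// ?uC ?leq_maxr// ltW.
Qed.

End GeometricBounds.

Section WeightedSum.
Context (R : realType) (T : Type) (c0 : R) (c0_gt0 : 0 < c0).
Context (th : nat -> T -> R).
Hypothesis th_ge0 : forall k y, 0 <= th k y.

Let c k : R := c0 * 2^-1 ^+ k.

Let c_ge0 k : 0 <= c k.
Proof. by rewrite mulr_ge0 ?exprn_ge0 ?invr_ge0// ltW. Qed.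

Let cS k : c k = 2 * c k.+1.
Proof. by rewrite /c exprS; field. Qed.

Definition geom_partial K y := \sum_(k < K) c0 * 2^-1 ^+ k * th k y.
(** As the terms are nonnegative the supremum of the partial sums is the sum of
    the series; upper bounds on all partial sums then bound it, and no convergence
    has to be discussed. *)
Definition geom_sum y := sup (range (geom_partial ^~ y)).

Lemma geom_partial0 y : geom_partial 0 y = 0.
Proof. by rewrite /geom_partial big_ord0. Qed.

Lemma geom_partialS K y :
  geom_partial K.+1 y = geom_partial K y + c0 * 2^-1 ^+ K * th K y.
Proof. by rewrite /geom_partial big_ord_recr. Qed.

Lemma geom_partial_homo K m y : geom_partial K y <= geom_partial (K + m) y.
Proof.
elim: m => [|m IH]; first by rewrite addn0.
by rewrite addnS geom_partialS; apply: le_trans IH _; rewrite lerDl mulr_ge0// c_ge0.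
Qed.

Lemma geom_partial_tail K m y D : (forall k, (K <= k)%N -> th k y <= D) ->
  geom_partial (K + m) y <=
  geom_partial K y + 2 * (c0 * 2^-1 ^+ K - c0 * 2^-1 ^+ (K + m)) * D.
Proof.
move=> thD; rewrite -!/(c _).
elim: m => [|m IH]; first by rewrite addn0 subrr mulr0 mul0r addr0.
rewrite addnS geom_partialS -/(c _); have := thD (K + m)%N (leq_addr _ _).
move=> /(ler_wpM2l (c_ge0 (K + m)%N)); have := cS (K + m)%N; rewrite -addnS.
by move: IH => /[swap] ->; set X := c (K + m)%N.+1; move=> IH; nra.
Qed.

Lemma geom_partial_le K y D : (forall k, th k y <= D) ->
  geom_partial K y <= geom_sum y.
Proof.
move=> thD; apply: sup_upper_bound; last by exists K.
split; first by exists (geom_partial 0 y), 0%N.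
exists (2 * c0 * D) => _ [m _ <-].
have := @geom_partial_tail 0 m y D (fun k _ => thD k).
rewrite geom_partial0 add0n add0r expr0 mulr1 => /le_trans; apply.
have := le_trans (th_ge0 0 y) (thD 0%N); have := c_ge0 m; rewrite /c.
by set X := c0 * _; nra.
Qed.

Lemma geom_sum_le b y K : (forall m, geom_partial (K + m) y <= b) -> geom_sum y <= b.
Proof.
move=> h; apply: ge_sup; first by exists (geom_partial 0 y), 0%N.
by move=> _ [m _ <-]; apply: le_trans (h m); rewrite addnC; exact: geom_partial_homo.
Qed.

Lemma geom_sum_tail K y D : (forall k, (K <= k)%N -> th k y <= D) ->
  geom_sum y <= geom_partial K y + 2 * (c0 * 2^-1 ^+ K) * D.
Proof.
move=> thD; apply: (@geom_sum_le _ _ K) => m.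
apply: le_trans (geom_partial_tail m thD) _; rewrite -!/(c _).
have D0 : 0 <= D := le_trans (th_ge0 K y) (thD K (leqnn _)).
by have := c_ge0 (K + m); nra.
Qed.

End WeightedSum.

Section WeightedSumNormed.
Context (R : realType) (Y : normedModType R) (c0 : R) (c0_gt0 : 0 < c0).
Context (th : nat -> Y -> R) (B : R).
Hypothesis th_ge0 : forall k y, 0 <= th k y.
Hypothesis th_lip : forall k x y, th k y <= th k x + `|y - x|.
Hypothesis th_B : forall k, th k 0 <= B.

Let th_bound (y : Y) k : th k y <= B + `|y|.
Proof. by apply: le_trans (th_lip _ 0 _) _; rewrite subr0 lerD2r. Qed.

Lemma geom_partial_le_normed K y : geom_partial c0 th K y <= geom_sum c0 th y.
Proof. exact: (geom_partial_le c0_gt0 th_ge0 K (th_bound y)). Qed.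

(** Up to a small Lipschitz constant, increments of the sum are increments of a
    partial sum, so that differentiability passes from partial sums to the sum. *)
Lemma geom_sum_diff K (x y : Y) :
  geom_sum c0 th y <= geom_sum c0 th x +
    (geom_partial c0 th K y - geom_partial c0 th K x) +
    2 * (c0 * 2^-1 ^+ K) * `|y - x|.
Proof.
pose c k : R := c0 * 2^-1 ^+ k.
have c_ge0 k : 0 <= c k by rewrite mulr_ge0 ?exprn_ge0 ?invr_ge0// ltW.
have cS k : c k = 2 * c k.+1 by rewrite /c exprS; field.
rewrite -/(c K).
apply: (geom_sum_le c0_gt0 th_ge0 (K := K)) => m; have := geom_partial_le_normed (K + m) x.
suff : geom_partial c0 th (K + m) y - geom_partial c0 th (K + m) x <=
    geom_partial c0 th K y - geom_partial c0 th K x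
    + 2 * (c K - c (K + m)%N) * `|y - x|.
  by have := c_ge0 (K + m)%N; have := normr_ge0 (y - x); nra.
elim: m => [|m IH]; first by rewrite addn0 !subrr mulr0 mul0r addr0.
rewrite addnS !geom_partialS -!/(c _); have := th_lip (K + m)%N x y.
move=> /(ler_wpM2l (c_ge0 (K + m)%N)); have := cS (K + m)%N; rewrite -addnS.
by move: IH => /[swap] ->; set X := c (K + m)%N.+1; move=> IH; nra.
Qed.

Lemma geom_sum_lip (x y : Y) : geom_sum c0 th y <= geom_sum c0 th x + 2 * c0 * `|y - x|.
Proof. by have := geom_sum_diff 0 x y; rewrite !geom_partial0 subrr addr0 expr0 mulr1. Qed.

Lemma geom_sum_convex : (forall k, convexf (th k)) -> convexf (geom_sum c0 th).
Proof.
move=> thc x y t t0 t1; apply: (geom_sum_le c0_gt0 th_ge0 (K := 0)) => m; rewrite add0n.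
have t1' : 0 <= 1 - t by rewrite subr_ge0.
apply: le_trans (lerD (ler_wpM2l t0 (geom_partial_le_normed m x))
  (ler_wpM2l t1' (geom_partial_le_normed m y))).
elim: m => [|m IH]; first by rewrite !geom_partial0 !mulr0 addr0.
have cm : 0 <= c0 * 2^-1 ^+ m by rewrite mulr_ge0 ?exprn_ge0 ?invr_ge0// ltW.
rewrite !geom_partialS; have /(ler_wpM2l cm) := thc m x y t t0 t1.
by move: IH; lra.
Qed.

End WeightedSumNormed.

Section Variational.
Context (R : realType) (Y : normedModType R) (Y_complete : is_complete Y).

(** The argument of Borwein and Preiss: near-minimizers [u k] are chosen
    successively, each for the function perturbed by the gauges at the previous
    ones.  A gauge need only approximate the distance within an error that
    tends to zero along the construction; therefore the functions given by
    [smooth_approximation] for the distances to points can serve as gauges. *)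
Lemma variational_principle (E : set Y) (H : Y -> R) (L c0 e : R)
    (g : Y -> R -> Y -> R) (u0 : Y) :
  closed E -> E u0 -> 0 < c0 -> 0 < e -> 0 <= L ->
  (forall x y, H y <= H x + L * `|y - x|) ->
  (forall w, E w -> H u0 <= H w + e) ->
  (forall u s y, 0 < s -> `|y - u| <= g u s y <= `|y - u| + s) ->
  (forall u s x y, 0 < s -> g u s y <= g u s x + `|y - x|) ->
  exists (u : nat -> Y) (s : nat -> R) (B : R) (v : Y),
    [/\ E v, `|v - u0| <= 6 * (e / c0), forall k, 0 < s k,
      forall k, g (u k) (s k) 0 <= B &
      forall w, E w -> H v + geom_sum c0 (fun k => g (u k) (s k)) v <=
                       H w + geom_sum c0 (fun k => g (u k) (s k)) w].
Proof.
move=> Ecl Eu0 c0_gt0 e_gt0 L_ge0 HL Hu0 gE gL.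
pose h k : R := 2^-1 ^+ k.
have h_gt0 k : 0 < h k by rewrite exprn_gt0// invr_gt0.
have h_le1 k : h k <= 1 by rewrite exprn_ile1// ?invr_ge0// invf_le1//; lra.
have hS k : h k.+1 = h k / 2 by rewrite /h exprSr.
pose s k := e / c0 * h k.
have s_gt0 k : 0 < s k by rewrite !mulr_gt0// invr_gt0.
have /choice[pick pickP] : forall kF : nat * (Y -> R), exists y,
    (exists b, forall w, E w -> b <= kF.2 w) ->
    E y /\ forall w, E w -> kF.2 y <= kF.2 w + e * h kF.1 ^+ 2.
  move=> -[k F] /=.
  have [[b Fb]|nb] := pselect (exists b, forall w, E w -> b <= F w); last by exists 0.
  have hi : has_inf (F @` E).
    by split; [exists (F u0), u0|exists b => _ [w Ew <-]; exact: Fb].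
  have e' : 0 < e * h k ^+ 2 by rewrite mulr_gt0// exprn_gt0.
  have [_ [w Ew <-] wlt] := inf_adherent e' hi.
  exists w => _; split=> // w' Ew' /=; apply: le_trans (ltW wlt) _.
  by rewrite lerD2r; apply: ge_inf; [case: hi|exists w'].
pose step k (z : Y * (Y -> R)) :=
  let F := fun y => z.2 y + c0 * h k * g z.1 (s k) y in (pick (k.+1, F), F).
pose st := fix st k := if k is k'.+1 then step k' (st k') else (u0, H).
pose u k := (st k).1; pose F k := (st k).2.
have FS k y : F k.+1 y = F k y + c0 * h k * g (u k) (s k) y by [].
have uS k : u k.+1 = pick (k.+1, F k.+1) by [].
have g_ge0 k y : 0 <= g (u k) (s k) y.
  by have /andP[+ _] := gE (u k) (s k) y (s_gt0 k); exact: le_trans.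
have FE k y : F k y = H y + geom_partial c0 (fun k => g (u k) (s k)) k y.
  elim: k => [|k IH]; first by rewrite /geom_partial big_ord0 addr0.
  by rewrite FS IH /geom_partial big_ord_recr /= addrA.
have Fge k w : E w -> H u0 - e <= F k w.
  move=> Ew; rewrite FE lerBlDr; apply: le_trans (Hu0 _ Ew) _.
  rewrite lerD2r lerDl; apply: sumr_ge0 => i _; rewrite mulr_ge0//.
  by rewrite mulr_ge0 ?ltW//; exact: h_gt0.
have uP k : E (u k) /\ forall w, E w -> F k (u k) <= F k w + e * h k ^+ 2.
  case: k => [|k]; first by split=> // w Ew; rewrite /h expr0 expr1n mulr1; exact: Hu0.
  by rewrite uS; apply: (pickP (k.+1, F k.+1)); exists (H u0 - e) => w; exact: Fge.
have c0e : c0 * (e / c0) = e by field; rewrite gt_eqF.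
have ec0 : 0 < e / c0 by rewrite divr_gt0.
have u1 k : `|u k.+1 - u k| <= 3 * (e / c0) * h k.
  have /andP[+ _] := gE (u k) (s k) (u k.+1) (s_gt0 k).
  have /andP[_] := gE (u k) (s k) (u k) (s_gt0 k); rewrite subrr normr0 add0r.
  have := (uP k.+1).2 _ (uP k).1; have := (uP k).2 _ (uP k.+1).1.
  rewrite !FS hS /s => h1 h2 h3 h4.
  have ch : 0 < c0 * h k by rewrite mulr_gt0.
  rewrite -(ler_pM2l ch).
  apply: le_trans (ler_wpM2l (ltW ch) h4) _.
  have := ler_wpM2l (ltW ch) h3.
  have -> : c0 * h k * (e / c0 * h k) = e * h k ^+ 2 by rewrite -{2}c0e; ring.
  have -> : c0 * h k * (3 * (e / c0) * h k) = 3 * (e * h k ^+ 2) by rewrite -{2}c0e; ring.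
  have : 0 < e * h k ^+ 2 by rewrite mulr_gt0// exprn_gt0.
  have e4 : e * (h k / 2) ^+ 2 = (e * h k ^+ 2) / 4 by field.
  rewrite e4 in h2.
  by move: h1 h2; set X := e * h k ^+ 2 => h1 h2; lra.
have uC k m : (k <= m)%N -> `|u m - u k| <= 6 * (e / c0) * h k.
  move=> km; suff : `|u m - u k| <= 6 * (e / c0) * (h k - h m).
    move=> /le_trans; apply; apply: ler_wpM2l; first by rewrite mulr_ge0// ltW.
    by rewrite gerBl ltW.
  elim: m km => [|m IH]; first by rewrite leqn0 => /eqP ->; rewrite !subrr normr0 mulr0.
  rewrite leq_eqVlt => /predU1P[<-|/IH{}IH]; first by rewrite !subrr normr0 mulr0.
  rewrite -(subrKA (u m)); apply: le_trans (ler_normD _ _) _.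
  by have := u1 m; rewrite hS; move: IH; lra.
have [v uv vu] := geom_cauchy_cvg Y_complete uC.
pose th k := g (u k) (s k).
have th_lip k x y : th k y <= th k x + `|y - x| by exact: gL.
pose B := `|u0| + 7 * (e / c0).
have sB k : s k <= e / c0 by rewrite /s ler_piMr// ltW.
have thB k : th k 0 <= B.
  have /andP[_ /le_trans] := gE (u k) (s k) 0 (s_gt0 k); apply.
  have : `|u k| <= `|u k - u0| + `|u0| by rewrite -{1}[u k](subrK u0) ler_normD.
  have := uC 0%N k isT; rewrite /h expr0 mulr1 sub0r normrN /B.
  by have := sB k; rewrite -/(u 0%N); lra.
exists u, s, B, v; split=> //.
- by apply: (closed_cvg _ Ecl _ _ uv); apply: nearW => k; exact: (uP k).1.
- by have := vu 0%N; rewrite expr0 mulr1.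
move=> w Ew; set P := geom_sum _ _.
have Plip x y : P y <= P x + 2 * c0 * `|y - x|.
  exact: (geom_sum_lip c0_gt0 g_ge0 th_lip thB).
apply: (@le_geom _ _ _ (15 * e + (L + 2 * c0) * (6 * (e / c0)))) => k.
have Pu : P (u k) <= geom_partial c0 th k (u k) + 2 * (c0 * h k) * (7 * (e / c0)).
  apply: (@geom_sum_tail _ _ _ c0_gt0 th g_ge0 k (u k) (7 * (e / c0))) => j kj.
  have /andP[_ /le_trans] := gE (u j) (s j) (u k) (s_gt0 j); apply.
  have := uC _ _ kj; rewrite distrC; have := sB j; have := h_le1 k.
  by have := normr_ge0 (u k - u j); nra.
have e14 : 2 * (c0 * h k) * (7 * (e / c0)) = 14 * e * h k.
  by rewrite -{2}c0e; ring.
rewrite e14 in Pu.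
have := (uP k).2 _ Ew; rewrite !FE -/th => h1.
have h2 : geom_partial c0 th k w <= P w.
  exact: (geom_partial_le_normed c0_gt0 g_ge0 th_lip thB).
have h3 := HL (u k) v; have h4 := Plip (u k) v.
have := vu k; rewrite -/(h k) => h5.
have h6 : (L + 2 * c0) * `|v - u k| <= (L + 2 * c0) * (6 * (e / c0) * h k).
  by rewrite ler_wpM2l// addr_ge0// mulr_ge0// ltW.
have h7 : e * h k ^+ 2 <= e * h k.
  by rewrite ler_pM2l// expr2 ler_piMr// ltW.
lra.
Qed.

End Variational.

(** * Bounded functionals and Fréchet derivatives of sublinear functionals *)

Section Functionals.
Context (R : realType) (Y : normedModType R).
Implicit Types (p f g : Y -> R) (Z : set Y).

Definition bounded_functional (L : R) f := scalar f /\ forall y, f y <= L * `|y|.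

Lemma bounded_functional_norm L f y : bounded_functional L f -> `|f y| <= L * `|y|.
Proof.
move=> [fs fL]; have [_ fN _ _] := scalarE fs.
by rewrite ler_norml fL andbT lerNl -fN -normrN fL.
Qed.

Lemma lip_continuous (L : R) f :
  (forall x y, f y <= f x + L * `|y - x|) -> continuous f.
Proof.
move=> fL x; apply/cvgrPdist_le => e e0.
have L1 : 0 < `|L| + 1 by rewrite ltr_wpDl.
apply/nbhs_ballP; exists (e / (`|L| + 1)); first exact: divr_gt0.
move=> y; rewrite -ball_normE /= ltr_pdivlMr// => xy.
have := fL x y; have := fL y x; rewrite [`|y - x|]distrC ler_norml.
have := ler_wpM2r (normr_ge0 (x - y)) (ler_norm L); have := normr_ge0 (x - y).
by move=> *; apply/andP; split; lra.
Qed.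

Lemma bounded_functional_dual L f : bounded_functional L f -> dual Y f.
Proof.
move=> [fs fL]; split=> //; apply: (@lip_continuous L) => x y.
have [_ fN fD _] := scalarE fs.
by rewrite -lerBlDl -fN -fD fL.
Qed.

Lemma dual_bounded_functional f : dual Y f -> exists2 L, 0 < L & bounded_functional L f.
Proof.
move=> [fs fc]; have [f0 fN fD fZ] := scalarE fs.
have /cvgrPdist_lt/(_ 1 ltr01) := fc 0.
rewrite f0 => /nbhs_ballP[r /= r0 fr].
exists (2 / r); first by rewrite divr_gt0.
split=> // y; have [->|y0] := eqVneq y 0; first by rewrite f0 normr0 mulr0.
have ny : 0 < `|y| by rewrite normr_gt0.
have t0 : 0 < r / (2 * `|y|) by rewrite divr_gt0// mulr_gt0.
have := fr ((r / (2 * `|y|)) *: y); rewrite -ball_normE /= !sub0r !normrN fZ normrZ.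
rewrite (gtr0_norm t0) => h.
have := le_lt_trans (ler_norm _) (h _).
have -> : r / (2 * `|y|) * `|y| = r / 2 by field; rewrite gt_eqF.
move=> /(_ ltac:(lra)) /ltW; rewrite mulrC -ler_pdivlMr// invf_div mul1r.
by rewrite mulrAC.
Qed.

Lemma sublinear_lip p x y : sublinear p -> (forall z, p z <= `|z|) ->
  p y <= p x + `|y - x|.
Proof.
move=> ps pn; rewrite -{1}[y](subrKC x).
by apply: le_trans (ps.1 _ _) _; rewrite lerD2l.
Qed.

Lemma norm_sublinear : sublinear (fun y : Y => `|y|).
Proof. by split=> [x y|t x t0]; rewrite ?ler_normD// normrZ gtr0_norm. Qed.

Lemma dist_convex (u : Y) : convexf (fun y => `|y - u|).
Proof.
have := convexf_translate (- u) 0 (sublinear_convexf norm_sublinear).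
by congr convexf; apply/funext => y; rewrite addr0 addrC.
Qed.

Lemma dist_triangle (x y z : Y) : `|y - z| <= `|x - z| + `|y - x|.
Proof. by rewrite [leRHS]addrC; exact: ler_distD. Qed.

Definition linear_subset Z :=
  Z 0 /\ forall (a : R) x y, Z x -> Z y -> Z (a *: x + y).

(** [f] is defined on the whole space because functionals on [Z] are always
    represented by functionals that extend them. *)
Lemma hahn_banach_extension Z p f : linear_subset Z -> sublinear p -> scalar f ->
  (forall z, Z z -> f z <= p z) ->
  exists g, [/\ scalar g, forall x, g x <= p x & forall z, Z z -> g z = f z].
Proof.
move=> [Z0 ZL] ps fs fp; have [f0 fN fD fZ] := scalarE fs.
pose G := [set c : Y * R | Z c.1 /\ c.2 = - f c.1].
have [||||| g [gs gp gG]] := @sandwich R Y p G (fun x => p (- x)) (sublinear_convexf ps).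
- by split=> //=; rewrite f0 oppr0.
- move=> [c1 c2] [d1 d2] [/= Zc ->] [/= Zd ->]; split=> /=.
    by have := ZL 1 _ _ Zc Zd; rewrite scale1r.
  by rewrite fD opprD.
- move=> t [c1 c2] t0 [/= Zc ->]; split=> /=.
    by have := ZL t _ _ Zc Z0; rewrite addr0.
  by rewrite fZ mulrN.
- by move=> x w; have := ps.1 (x + w) (- x); rewrite addrC addKr.
- by move=> [c1 c2] [/= Zc ->]; rewrite subr_ge0; exact: fp.
exists g; split=> // z Zz; have [_ gN _ _] := scalarE gs.
have Zn : Z (- z) by have := ZL (-1) _ _ Zz Z0; rewrite addr0 scaleN1r.
have := gG (z, - f z) (conj Zz erefl); have := gG (- z, - f (- z)) (conj Zn erefl).
by rewrite /= gN fN; lra.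
Qed.

(** Only the upper estimate of Fréchet differentiability is kept, as convexity
    gives the other one. *)
Lemma asplund_sublinear p : asplund Y -> sublinear p -> (forall y, p y <= `|y|) ->
  exists (y : Y) (f : Y -> R), scalar f /\ forall e, 0 < e -> exists2 r, 0 < r &
    forall h, `|h| <= r -> p (y + h) <= p y + f h + e * `|h|.
Proof.
move=> aY ps pn.
have [||||y [[_ /= dp] _]] := (aY setT p openT _ _ _ 0 I) setT _.
- by move=> x y l _ _; rewrite inE.
- by move=> t x y _ _; apply: (sublinear_convexf ps).
- move=> x _; apply: (@lip_continuous 1) => {}x y; rewrite mul1r; exact: sublinear_lip.
- exact: filterT.
exists y, ('d p y); split; first by move=> a u v; rewrite linearP.
move=> e e0; have /diff_locally/eqaddoP/(_ _ e0) := dp.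
move=> /nbhs_ballP[r /= r0 pr]; exists (r / 2); first by rewrite divr_gt0.
move=> h hr; have := pr h; rewrite -ball_normE /= sub0r normrN.
move=> /(_ ltac:(lra)) /(le_trans (ler_norm _)).
by rewrite !fctE /= [h + y]addrC; lra.
Qed.

End Functionals.

(** * Separable subspaces of Asplund spaces have separable duals *)

Lemma countable_enum T (A : set T) : countable A -> A !=set0 ->
  exists F : nat -> T, (forall n, A (F n)) /\ forall x, A x -> exists n, F n = x.
Proof.
move=> /countable_injP[f finj] [x0 Ax0].
have /choice[F FP] : forall n, exists y, A y /\ forall x, A x -> f x = n -> y = x.
  move=> n; have [[y [Ay fy]]|nx] := pselect (exists x, A x /\ f x = n).
    by exists y; split=> // x Ax fx; apply: finj; rewrite ?inE// fy fx.
  by exists x0; split=> // x Ax fx; exfalso; apply: nx; exists x.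
exists F; split=> [n|x Ax]; first exact: (FP n).1.
by exists (f x); exact: (FP (f x)).2.
Qed.

Section SeparableDual.
Context (R : realType) (Y : normedModType R) (Y_asplund : asplund Y).
Context (S Z : set Y).
Hypothesis S_countable : countable S.
Hypothesis S0 : S 0.
Hypothesis SZ : S `<=` Z.
Hypothesis Z_subspace : linear_subset Z.
Hypothesis S_dense : forall z e, Z z -> 0 < e -> exists2 s, S s & `|z - s| < e.

(** The distance of the restrictions to [Z], in the dual norm, is at most [e]. *)
Definition near_on (f g : Y -> R) (e : R) :=
  forall z, Z z -> `|f z - g z| <= e * `|z|.

Let B1 : set (Y -> R) := [set f | bounded_functional 1 f].

Let small e (T : set (Y -> R)) := exists F : set (Y -> R),
  [/\ countable F, F `<=` B1 & forall f, T f -> exists2 g, F g & near_on f g e].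

Let slice (zq : Y * rat) := [set f | B1 f /\ ratr zq.2 < f zq.1].

(** Suppose that no countable set is [e]-dense and remove from the unit ball all
    slices [{f | q < f z}], with [z] in [S] and rational [q], that are covered by
    countably many balls of radius [e].  What remains is a nonempty set [A] each
    of whose slices contains two points at distance more than [e].

    Let [p] be minimal among the sublinear functionals that dominate [A] on
    [S], and [y] a point where [p] has a Fréchet derivative.  Linear [g <= p]
    with [g y] close to [p y] are close to the derivative, hence to each other.
    The supremum [q] of the other linear [g <= p] is a sublinear functional
    with [q y < p y], so by minimality [q z < a z] for some [a] in [A] and [z] in
    [S].  The slice of [A] at [z] above [q z] therefore extends to functionals
    that are all close to the derivative of [p]: a contradiction. *)
Lemma unit_ball_separable e : 0 < e -> small e B1.
Proof.
move=> e0; apply: contrapT => nsmall.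
pose A := [set f | B1 f /\ forall zq, S zq.1 -> slice zq f -> ~ small e (slice zq)].
have /choice[F FP] : forall zq, exists F : set (Y -> R), small e (slice zq) ->
    [/\ countable F, F `<=` B1 & forall f, slice zq f -> exists2 g, F g & near_on f g e].
  move=> zq; have [[F FP]|ns] := pselect (small e (slice zq)); first by exists F.
  by exists set0.
(* Outside [A] countably many balls suffice by construction, so that only the part
   of [T] in [A] matters. *)
have bigsmall T g : T `<=` B1 -> B1 g ->
    (forall f, T f -> A f -> near_on f g e) -> small e T.
  move=> TB gB Tg.
  exists ([set g] `|` \bigcup_(zq in [set zq | S zq.1 /\ small e (slice zq)]) F zq).
  split.
  - rewrite -bigcup2E; apply: bigcup_countable => // -[|[|i]] _; rewrite /bigcup2 //=.
    apply: bigcup_countable => [|zq [_ /FP[]]//].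
    apply: (@sub_countable _ _ _ (S `*` [set: rat])); last first.
      exact: countableX.
    by apply: subset_card_le => -[z q] [/= Sz _].
  - by move=> f [->//|[zq [_ /FP[_ + _]]]]; exact.
  - move=> f Tf; have [Af|nAf] := pselect (A f).
      by exists g; [left|exact: Tg].
    have [zq [Szq sf sm]] : exists zq, [/\ S zq.1, slice zq f & small e (slice zq)].
      apply: contrapT => h; apply: nAf; split; first exact: TB.
      by move=> zq Szq sf sm; apply: h; exists zq.
    have [_ _ /(_ _ sf)[k Fk fk]] := FP _ sm.
    by exists k => //; right; exists zq.
have B0 : B1 (cst 0).
  by split=> [a x y|y]; rewrite /cst ?mulr0 ?addr0// mul1r.
have [a0 Aa0] : A !=set0.
  apply: contrapT => A0; apply: nsmall; apply: (@bigsmall _ (cst 0)) => // f _ Af.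
  by exfalso; apply: A0; exists f.
have Afar a z q : A a -> S z -> ratr q < a z ->
    exists b, [/\ A b, ratr q < b z & ~ near_on b a e].
  move=> [Ba Aa] Sz qa; apply: contrapT => h.
  apply: (Aa (z, q)) => //; apply: (@bigsmall _ a) => // [f []//|f [_ /= qf] Af].
  by apply: contrapT => nf; apply: h; exists f.
have [p [ps pn pA pmin]] := @minimal_sublinear R Y (fun y => `|y|)
  [set c | S c.1 /\ exists2 a, A a & c.2 = a c.1] (norm_sublinear Y)
  ltac:(move=> [z t] [/= _ [a [[_ aB] _] ->]]; by rewrite -[leRHS]mul1r).
have ext a : A a -> exists g, [/\ scalar g, forall x, g x <= p x &
    forall z, Z z -> g z = a z].
  move=> Aa; have [[as_ aB] _] := Aa; have [_ aN aD _] := scalarE as_.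
  apply: (hahn_banach_extension Z_subspace ps as_) => z Zz; apply/ler_addgt0Pr => d d0.
  have d2 : 0 < d / 2 by rewrite divr_gt0.
  have [s Ss zs] := S_dense Zz d2.
  have h1 := pA (s, a s) (conj Ss (ex_intro2 _ _ a Aa erefl)).
  have h2 := sublinear_lip z s ps pn; have h3 := aB (z - s).
  by move: h1 h2 h3; rewrite /= [`|s - z|]distrC aD aN; lra.
have [y [f [fs fp]]] := asplund_sublinear Y_asplund ps pn.
have e4 : 0 < e / 4 by rewrite divr_gt0.
have [r r0 fr] := fp _ e4.
have [f0 fN fD fZ] := scalarE fs.
(* [g <= p] is tested at distance [r] from [y], where the error in the derivative is
   comparable to the defect [e / 4 * r] of [g] at [y]. *)
have slice_small g x : scalar g -> (forall x, g x <= p x) ->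
    p y - e / 4 * r < g y -> `|g x - f x| <= e / 2 * `|x|.
  move=> gs gp gy; have [g0 gN gD gZ] := scalarE gs.
  suff half u : g u - f u <= e / 2 * `|u|.
    by rewrite ler_norml half andbT; have := half (- x); rewrite gN fN normrN; lra.
  have [->|u0] := eqVneq u 0; first by rewrite g0 f0 normr0 mulr0 subrr.
  have nu : 0 < `|u| by rewrite normr_gt0.
  have ru : 0 < r / `|u| by rewrite divr_gt0.
  have hn : `|(r / `|u|) *: u| = r by rewrite normrZ gtr0_norm// divfK// gt_eqF.
  have := fr ((r / `|u|) *: u); rewrite hn => /(_ (lexx _)).
  have := gp (y + (r / `|u|) *: u); rewrite gD gZ fZ => h1 h2.
  rewrite -(ler_pM2l ru).
  have -> : r / `|u| * (e / 2 * `|u|) = e / 2 * r by field; rewrite gt_eqF.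
  by lra.
pose D := [set g | [/\ scalar g, forall x, g x <= p x & g y <= p y - e / 4 * r]].
have far_absurd a b ga gb : A a -> A b -> ~ near_on b a e ->
    [/\ scalar ga, forall x, ga x <= p x & forall z, Z z -> ga z = a z] ->
    [/\ scalar gb, forall x, gb x <= p x & forall z, Z z -> gb z = b z] ->
    ~ D ga -> ~ D gb -> False.
  move=> Aa Ab nab [gas gap gaE] [gbs gbp gbE] nDa nDb; apply: nab => z Zz.
  have gay : p y - e / 4 * r < ga y.
    by rewrite ltNge; apply/negP => h; apply: nDa.
  have gby : p y - e / 4 * r < gb y.
    by rewrite ltNge; apply/negP => h; apply: nDb.
  rewrite -gaE// -gbE//.
  have := slice_small _ z gas gap gay; have := slice_small _ z gbs gbp gby.
  by rewrite !ler_norml => /andP[? ?] /andP[? ?]; apply/andP; split; lra.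
(* If [D] is empty, every element of [A] is close to [f]; the slice at [0] above [-1] is
   all of [A]. *)
have [D0|D0] := pselect (D !=set0); last first.
  have m1 : ratr (-1) < a0 0 :> R.
    have [-> _ _ _] := scalarE Aa0.1.1.
    by rewrite rmorphN1 oppr_lt0 ltr01.
  have [b [Ab _ nb]] := Afar _ _ _ Aa0 S0 m1.
  have [ga gaP] := ext _ Aa0; have [gb gbP] := ext _ Ab.
  by apply: (far_absurd _ _ _ _ Aa0 Ab nb gaP gbP) => Dg; apply: D0; [exists ga|exists gb].
pose q x := sup [set g x | g in D].
have qub x g : D g -> g x <= q x.
  move=> Dg; apply: sup_upper_bound; last by exists g.
  split; first by exists (g x), g.
  by exists (p x) => _ [k [_ kp _] <-]; exact: kp.
have qle x b : (forall g, D g -> g x <= b) -> q x <= b.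
  move=> h; apply: ge_sup; first by case: D0 => g Dg; exists (g x), g.
  by move=> _ [g Dg <-]; exact: h.
have qs : sublinear q.
  apply: sublinearW => [u w|t u t0].
    apply: (qle) => g Dg; have [_ _ gD _] := scalarE (let: And3 h _ _ := Dg in h).
    by rewrite gD lerD// qub.
  apply: (qle) => g Dg; have [_ _ _ gZ] := scalarE (let: And3 h _ _ := Dg in h).
  by rewrite gZ ler_pM2l// qub.
have [a [z [Aa Sz qa]]] : exists a z, [/\ A a, S z & q z < a z].
  apply: contrapT => h.
  have := pmin q qs (fun x => qle x _ (fun g Dg => (let: And3 _ h _ := Dg in h) x)).
  have qC : forall c : Y * R, (S c.1 /\ exists2 a, A a & c.2 = a c.1) -> c.2 <= q c.1.
    move=> [z t] [/= Sz [a Aa ->]]; rewrite leNgt; apply/negP => qa.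
    by apply: h; exists a, z.
  move=> /(_ qC y).
  have : q y <= p y - e / 4 * r by apply: (qle) => g [].
  have er : 0 < e / 4 * r by rewrite mulr_gt0.
  lra.
have [t] := rat_in_itvoo qa; rewrite in_itv/= => /andP[qt ta].
have [b [Ab tb nb]] := Afar _ _ _ Aa Sz ta.
have [ga gaP] := ext _ Aa; have [gb gbP] := ext _ Ab.
have Zz := SZ Sz.
apply: (far_absurd _ _ _ _ Aa Ab nb gaP gbP) => /(qub z).
- by case: gaP => _ _ ->//; rewrite leNgt (lt_trans qt).
- by case: gbP => _ _ ->//; rewrite leNgt (lt_trans qt).
Qed.

Lemma separable_dual : exists F : nat -> Y -> R, (forall n, dual Y (F n)) /\
  forall f e, dual Y f -> 0 < e -> exists n, near_on f (F n) e.
Proof.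
have /choice[F FP] : forall k : nat, small k.+1%:R^-1 B1.
  by move=> k; apply: unit_ball_separable; rewrite invr_gt0.
pose G := \bigcup_(k in [set: nat * nat]) [set (fun x => k.2.+1%:R * g x) | g in F k.1].
have [||E [EG GE]] := @countable_enum _ G.
- apply: bigcup_countable => // k _; apply: sub_countable (card_image_le _ _) _.
  by have [] := FP k.1.
- have B0 : B1 (cst 0).
    by split=> [a x y|y]; rewrite /cst ?mulr0 ?addr0// mul1r.
  have [_ _ /(_ _ B0)[g Fg _]] := FP 0%N.
  by exists (fun x => 1%:R * g x), (0, 0)%N => //; exists g.
exists E; split.
  move=> n; have [k _ [g Fg <-]] := EG n.
  have [_ /(_ _ Fg)[gs gB] _] := FP k.1.
  apply: (@bounded_functional_dual _ _ k.2.+1%:R); split.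
    by move=> a x y; rewrite gs mulrDr mulrCA.
  by move=> y; rewrite ler_wpM2l//; have := gB y; rewrite mul1r.
move=> f e /dual_bounded_functional[L L0 [fs fL]] e0.
pose n := Num.truncn L; have Ln : L < n.+1%:R by exact: truncnS_gt.
pose k := Num.truncn (n.+1%:R / e); have kn : n.+1%:R / e < k.+1%:R by exact: truncnS_gt.
have n0 : 0 < n.+1%:R :> R by [].
have k0 : 0 < k.+1%:R :> R by [].
have Bf : B1 (fun x => n.+1%:R^-1 * f x).
  split=> [a x y|y]; first by rewrite fs mulrDr mulrCA.
  rewrite mul1r ler_pdivrMl//; apply: le_trans (fL y) _.
  by rewrite ler_wpM2r// ltW.
have [_ _ /(_ _ Bf)[g Fg fg]] := FP k.
have [m mE] : exists m, E m = (fun x => n.+1%:R * g x).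
  by apply: GE; exists (k, n) => //; exists g.
exists m => z Zz; rewrite mE; have := fg z Zz.
rewrite -(ler_pM2l n0) -{1}[n.+1%:R]gtr0_norm// -normrM mulrBr mulrA mulfV ?gt_eqF//.
rewrite mul1r => /le_trans; apply; rewrite mulrA ler_wpM2r//.
by rewrite ler_pdivrMr// mulrC -ler_pdivrMr// ltW.
Qed.

End SeparableDual.

(** * Smooth approximation of convex functions along a subspace *)

Section SeminormOn.
Context (R : realType) (Y : normedModType R) (Z : set Y).
Implicit Types f g : Y -> R.

(** The dual norm of the restriction of [g] to [Z]. *)
Definition norm_over g := sup [set `|g z| | z in [set z | Z z /\ `|z| <= 1]].

Hypothesis Z_lin : linear_subset Z.

Lemma linear_subsetZ a z : Z z -> Z (a *: z).
Proof. by move=> Zz; rewrite -[_ *: _]addr0; apply: Z_lin.2 => //; exact: Z_lin.1. Qed.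

Lemma norm_over_le g b : (forall z, Z z -> `|z| <= 1 -> `|g z| <= b) -> norm_over g <= b.
Proof.
move=> gb; apply: ge_sup; last by move=> _ [z [Zz z1] <-]; exact: gb.
by exists `|g 0|, 0 => //; split; [exact: Z_lin.1|rewrite normr0].
Qed.

Lemma le_norm_over L g z : (forall y, `|g y| <= L * `|y|) -> Z z -> `|z| <= 1 ->
  `|g z| <= norm_over g.
Proof.
move=> gL Zz z1; apply: sup_upper_bound; last by exists z.
split; first by exists `|g z|, z.
exists `|L| => _ [u [Zu u1] <-]; apply: le_trans (gL u) _.
by have := ler_norm L; have := normr_ge0 u; have := normr_ge0 L; nra.
Qed.

Lemma norm_over_ge0 L g : (forall y, `|g y| <= L * `|y|) -> 0 <= norm_over g.
Proof.
move=> gL; apply: le_trans (normr_ge0 (g 0)) (le_norm_over gL Z_lin.1 _).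
by rewrite normr0.
Qed.

Lemma norm_overP L g z : scalar g -> (forall y, `|g y| <= L * `|y|) -> Z z ->
  `|g z| <= norm_over g * `|z|.
Proof.
move=> gs gL Zz; have [g0 gN gD gZ] := scalarE gs.
have [->|z0] := eqVneq z 0; first by rewrite g0 !normr0 mulr0.
have nz : 0 < `|z| by rewrite normr_gt0.
have := le_norm_over gL (linear_subsetZ `|z|^-1 Zz).
rewrite normrZ gZ normrM normfV normr_id mulVf ?gt_eqF// lexx => /(_ isT).
by rewrite mulrC ler_pdivrMr.
Qed.

End SeminormOn.

(** Half of Fréchet differentiability along [Z].  The functional may depend on
    [e], which makes the notion stable under [geom_sum]; a convex function
    admits a single functional for all [e], see [superdiff_convex]. *)
Definition superdiff (R : realType) (Y : normedModType R) (Z : set Y) (W : Y -> R) v :=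
  forall e, 0 < e -> exists xi : Y -> R,
  scalar xi /\ exists2 r, 0 < r &
  forall z, Z z -> `|z| <= r -> W (v + z) <= W v + xi z + e * `|z|.

Section Smoothing.
Context (R : realType) (Y : normedModType R) (Z : set Y) (Z_lin : linear_subset Z).
Context (F : nat -> Y -> R) (F_dual : forall n, dual Y (F n)).
Hypothesis F_dense : forall f e, dual Y f -> 0 < e -> exists n, near_on Z f (F n) e.
Context (L s : R) (L_ge0 : 0 <= L) (s_gt0 : 0 < s) (G : Y -> R) (G_convex : convexf G).
Hypothesis G_lip : forall x y, G y <= G x + L * `|y - x|.

Lemma exists_common_bounds : exists K : nat -> R, forall n, 0 < K n /\
  forall f y, bounded_functional L f -> `|(f \- F n) y| <= K n * `|y|.
Proof.
have /choice[K KP] : forall n, exists K, 0 < K /\ bounded_functional K (F n).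
  by move=> n; have [K K0 KP] := dual_bounded_functional (F_dual n); exists K.
exists (fun n => L + K n) => n; have [K0 FK] := KP n; split.
  by rewrite ltr_wpDl.
move=> f y fL; apply: le_trans (ler_normB _ _) _; rewrite mulrDl.
by apply: lerD; exact: bounded_functional_norm.
Qed.

Definition dist_scale n : R := projT1 (cid exists_common_bounds) n.

Lemma dist_scale_gt0 n : 0 < dist_scale n.
Proof. by rewrite /dist_scale; case: cid => K /= /(_ n)[]. Qed.

Lemma dist_scale_bound n f y : bounded_functional L f ->
  `|(f \- F n) y| <= dist_scale n * `|y|.
Proof. by rewrite /dist_scale; case: cid => K /= /(_ n)[_]; exact. Qed.

Definition rel_dist n f : R := norm_over Z (f \- F n) / dist_scale n.

(** Its value is in [[0, 1]], whatever the family [F], thanks to the scaling of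
    the distances. *)
Definition convexifier f : R := geom_sum 2^-1 (fun n f => rel_dist n f ^+ 2) f.

Local Notation partial := (geom_partial 2^-1 (fun n (f : Y -> R) => rel_dist n f ^+ 2)).

Lemma rel_dist_ge0 n f : bounded_functional L f -> 0 <= rel_dist n f.
Proof.
move=> fL; apply: divr_ge0; last exact: ltW (dist_scale_gt0 n).
by apply: (norm_over_ge0 Z_lin (L := dist_scale n)) => y; exact: dist_scale_bound.
Qed.

Lemma rel_dist_le1 n f : bounded_functional L f -> rel_dist n f <= 1.
Proof.
move=> fL; rewrite ler_pdivrMr ?dist_scale_gt0// mul1r; apply: norm_over_le => // z Zz z1.
apply: le_trans (dist_scale_bound n z fL) _.
by rewrite ler_piMr// ltW// dist_scale_gt0.
Qed.

Let half_gt0 : 0 < 2^-1 :> R. Proof. by rewrite invr_gt0. Qed.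
Let sq_ge0 n (f : Y -> R) : 0 <= rel_dist n f ^+ 2. Proof. exact: sqr_ge0. Qed.
Let sq_le1 f : bounded_functional L f -> forall n, rel_dist n f ^+ 2 <= 1.
Proof. by move=> fL n; rewrite expr_le1// ?rel_dist_le1 ?rel_dist_ge0. Qed.

Lemma partial_le K f : bounded_functional L f -> partial K f <= convexifier f.
Proof. by move=> fL; exact: (geom_partial_le half_gt0 sq_ge0 K (sq_le1 fL)). Qed.

Lemma convexifier_ge0 f : bounded_functional L f -> 0 <= convexifier f.
Proof.
move=> fL; apply: le_trans (partial_le 0 fL).
by rewrite geom_partial0.
Qed.

Lemma convexifier_le1 f : bounded_functional L f -> convexifier f <= 1.
Proof.
move=> fL; have := @geom_sum_tail _ _ _ half_gt0 _ sq_ge0 0 f 1 (fun k _ => sq_le1 fL k).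
by rewrite geom_partial0 expr0 !mulr1 mulfV// add0r.
Qed.

Definition midpoint f g : Y -> R := fun y => 2^-1 * (f y + g y).

Lemma bounded_functional_mid f g : bounded_functional L f -> bounded_functional L g ->
  bounded_functional L (midpoint f g).
Proof.
move=> [fs fL] [gs gL]; split=> [a x y|y]; first by rewrite /midpoint fs gs; ring.
by rewrite /midpoint; have := fL y; have := gL y; lra.
Qed.

Lemma rel_dist_mid n f g : bounded_functional L f -> bounded_functional L g ->
  rel_dist n (midpoint f g) <= 2^-1 * (rel_dist n f + rel_dist n g).
Proof.
move=> fL gL; rewrite /rel_dist -mulrDl mulrA ler_pM2r ?invr_gt0 ?dist_scale_gt0//.
apply: norm_over_le => // z Zz z1.
have := le_norm_over (fun y => dist_scale_bound n y fL) Zz z1.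
have := le_norm_over (fun y => dist_scale_bound n y gL) Zz z1.
rewrite /midpoint /= => h1 h2.
have -> : 2^-1 * (f z + g z) - F n z = 2^-1 * ((f z - F n z) + (g z - F n z)) by field.
rewrite normrM ger0_norm ?invr_ge0// ler_pM2l ?invr_gt0//.
by apply: le_trans (ler_normD _ _) _; rewrite lerD.
Qed.

(** Each term is the square of a convex function, which makes the sum strictly
    midpoint convex in every coordinate [rel_dist n].  If two functionals are
    almost as good as their midpoint then they have almost the same distances
    to all the [F n]. *)
Lemma convexifier_mid n f g : bounded_functional L f -> bounded_functional L g ->
  convexifier (midpoint f g) <= 2^-1 * (convexifier f + convexifier g) -
    2^-1 * 2^-1 ^+ n * (2^-1 * (rel_dist n f - rel_dist n g)) ^+ 2.
Proof.
move=> fL gL; apply: (geom_sum_le half_gt0 sq_ge0 (K := n.+1)) => m.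
have := partial_le (n.+1 + m) fL; have := partial_le (n.+1 + m) gL.
have sq k : rel_dist k (midpoint f g) ^+ 2 <= 2^-1 * (rel_dist k f ^+ 2 + rel_dist k g ^+ 2)
    - (2^-1 * (rel_dist k f - rel_dist k g)) ^+ 2.
  have h0 := rel_dist_ge0 k (bounded_functional_mid fL gL).
  have := rel_dist_mid k fL gL.
  move: h0; move: (rel_dist k f) (rel_dist k g) (rel_dist k (midpoint f g)) => x y z.
  by nra.
have w0 k : 0 <= 2^-1 * 2^-1 ^+ k :> R by rewrite mulr_ge0 ?exprn_ge0 ?invr_ge0.
have part k : partial k (midpoint f g) <= 2^-1 * (partial k f + partial k g).
  elim: k => [|k IH]; first by rewrite !geom_partial0 addr0 mulr0.
  rewrite !geom_partialS /=; have := ler_wpM2l (w0 k) (sq k).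
  have := mulr_ge0 (w0 k) (sqr_ge0 (2^-1 * (rel_dist k f - rel_dist k g))).
  by move: IH; lra.
suff : partial (n.+1 + m) (midpoint f g) <=
    2^-1 * (partial (n.+1 + m) f + partial (n.+1 + m) g)
    - 2^-1 * 2^-1 ^+ n * (2^-1 * (rel_dist n f - rel_dist n g)) ^+ 2 by lra.
elim: m => [|m IH].
  rewrite addn0 !geom_partialS /=; have := ler_wpM2l (w0 n) (sq n); have := part n; lra.
move: IH; rewrite addnS; move: (n.+1 + m)%N => k IH; rewrite !geom_partialS /=; move: IH.
have := ler_wpM2l (w0 k) (sq k).
have := mulr_ge0 (w0 k) (sqr_ge0 (2^-1 * (rel_dist k f - rel_dist k g))).
set w := 2^-1 * 2^-1 ^+ k; set c := 2^-1 * 2^-1 ^+ n * _ ^+ 2.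
by move: (rel_dist k _) (rel_dist k _) (rel_dist k _) => x y z; clearbody w c => *; lra.
Qed.

(** The pair stands for the affine function with slope [p.1] and constant term
    [p.2]; the supremum of these functions is [G]. *)
Definition affine_minorant (p : (Y -> R) * R) :=
  bounded_functional L p.1 /\ forall y, p.1 y + p.2 <= G y.

Definition penalized_value (p : (Y -> R) * R) y := p.1 y + p.2 - s * convexifier p.1.

Definition regularized y := sup [set penalized_value p y | p in affine_minorant].

Lemma exact_minorant y : exists2 p, affine_minorant p & p.1 y + p.2 = G y.
Proof.
have [f [fs fG]] := subgradient y G_convex.
have [_ fN fD _] := scalarE fs.
exists (f, G y - f y); last by rewrite /= addrC subrK.
split=> /=; first split=> //= z.
  apply: le_trans (fG z) _; have := G_lip y (y + z).
  by rewrite [y + z - y]addrAC subrr add0r; lra.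
by move=> z; have := fG (z - y); rewrite [y + _]addrC subrK fD fN; lra.
Qed.

Lemma penalized_value_le_G p y : affine_minorant p -> penalized_value p y <= G y.
Proof.
move=> [pL pG]; have := pG y; have := convexifier_ge0 pL.
by rewrite /penalized_value; have := mulr_ge0 (ltW s_gt0) (convexifier_ge0 pL); lra.
Qed.

Lemma penalized_value_le p y : affine_minorant p -> penalized_value p y <= regularized y.
Proof.
move=> mp; apply: sup_upper_bound; last by exists p.
split; first by exists (penalized_value p y), p.
by exists (G y) => _ [q mq <-]; exact: penalized_value_le_G.
Qed.

Lemma regularized_le y b :
  (forall p, affine_minorant p -> penalized_value p y <= b) -> regularized y <= b.
Proof.
move=> h; apply: ge_sup; last by move=> _ [q mq <-]; exact: h.
by have [p mp _] := exact_minorant 0; exists (penalized_value p y), p.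
Qed.

Lemma regularized_le_G y : regularized y <= G y.
Proof. by apply: regularized_le => p; exact: penalized_value_le_G. Qed.

Lemma G_le_regularized y : G y <= regularized y + s.
Proof.
have [p mp py] := exact_minorant y; have := penalized_value_le y mp.
rewrite /penalized_value py; have := ler_wpM2l (ltW s_gt0) (convexifier_le1 mp.1).
by lra.
Qed.

Lemma regularized_lip x y : regularized y <= regularized x + L * `|y - x|.
Proof.
apply: regularized_le => p mp; have := penalized_value_le x mp; rewrite /penalized_value.
have [_ fN fD _] := scalarE mp.1.1.
by have := mp.1.2 (y - x); rewrite fD fN; lra.
Qed.

Lemma regularized_convex : convexf regularized.
Proof.
move=> x y t t0 t1; apply: regularized_le => p mp.
have t1' : 0 <= 1 - t by rewrite subr_ge0.
have := ler_wpM2l t0 (penalized_value_le x mp).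
have := ler_wpM2l t1' (penalized_value_le y mp).
have [_ _ fD fZ] := scalarE mp.1.1.
by rewrite /penalized_value fD !fZ; lra.
Qed.

Lemma near_maximizer v e : 0 < e ->
  exists p, affine_minorant p /\ regularized v - e <= penalized_value p v.
Proof.
move=> e0; apply: contrapT => h.
have : regularized v <= regularized v - e.
  apply: regularized_le => p mp; rewrite leNgt; apply/negP => /ltW hp.
  by apply: h; exists p.
by lra.
Qed.

(** Ultrafilters take the place of the weak-star compactness of bounded sets of
    functionals. *)
Lemma near_bounded (U : set_system ((Y -> R) * R)) (phi : (Y -> R) * R -> R) (b : R) :
  UltraFilter U -> U [set p | `|phi p| <= b] -> exists l : R, phi @ U --> l.
Proof.
move=> UU Ub; have UI : UltraFilter (phi @ U).
  split=> [|H HF UH]; first exact: fmap_proper_filter.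
  rewrite predeqE => A; split=> [HA|]; last exact: UH.
  have [//|UA] := in_ultra_setVsetC (phi @^-1` A) UU.
  have HnA : H (~` A) by exact: UH.
  by have [x []] := filter_ex (filterI HA HnA).
have h : (phi @ U) `[- b, b]%classic.
  suff : U (phi @^-1` `[- b, b]%classic) by [].
  by apply: filterS Ub => p /=; rewrite in_itv/= ler_norml.
have := @segment_compact R (- b) b; rewrite compact_ultra.
by move=> /(_ _ UI h)[l [_ /= lU]]; exists l.
Qed.

(** Evaluations converge along an ultrafilter of near-maximizers, and the
    penalty is lower semicontinuous for pointwise convergence. *)
Lemma maximizer v : exists2 p, affine_minorant p & regularized v <= penalized_value p v.
Proof.
pose M e := [set p | affine_minorant p /\ regularized v - e <= penalized_value p v].
have MF : ProperFilter (filter_from [set e : R | 0 < e] M).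
  apply: filter_from_proper; last by move=> e /= e0; exact: near_maximizer.
  apply: filter_from_filter; first by exists 1 => /=.
  move=> i j /= i0 j0; exists (Num.min i j); first by rewrite lt_min i0.
  move=> p [mp pv]; split; split=> //.
    have : Num.min i j <= i by rewrite ge_min lexx.
    by lra.
  have : Num.min i j <= j by rewrite ge_min lexx orbT.
  by lra.
have [U [UU MU]] := ultraFilterLemma MF.
have UM e : 0 < e -> U (M e) by move=> e0; apply: MU; exists e.
have Um : U [set p | affine_minorant p] by apply: filterS (UM 1 ltr01) => p [].
have /choice[f fU] : forall y, exists l : R, (fun p => p.1 y) @ U --> l.
  move=> y; apply: (@near_bounded _ _ (L * `|y|)).
  by apply: filterS Um => p [pL _] /=; exact: bounded_functional_norm.
have [a aU] : exists l : R, (fun p => p.2) @ U --> l.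
  apply: (@near_bounded _ _ (`|G 0| + `|regularized v| + L * `|v| + 1)).
  apply: filterS (UM 1 ltr01) => p [[pL pG] pv] /=.
  have [p0 _ _ _] := scalarE pL.1.
  have := pG 0; rewrite p0 add0r; have := pL.2 v.
  have := mulr_ge0 (ltW s_gt0) (convexifier_ge0 pL); move: pv; rewrite /penalized_value.
  have := ler_norm (G 0); have := ler_norm (- regularized v); rewrite normrN.
  have := normr_ge0 (G 0); have := normr_ge0 (regularized v).
  have := mulr_ge0 L_ge0 (normr_ge0 v).
  by rewrite ler_norml => *; apply/andP; split; lra.
have fnear y e : 0 < e -> U [set p | `|p.1 y - f y| <= e].
  by move=> e0; have /cvgrPdist_le/(_ _ e0) := fU y; apply: filterS => p /=; rewrite distrC.
have anear e : 0 < e -> U [set p | `|p.2 - a| <= e].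
  by move=> e0; have /cvgrPdist_le/(_ _ e0) := aU; apply: filterS => p /=; rewrite distrC.
have fL : bounded_functional L f.
  split=> [b x y|y]; last first.
    apply/ler_addgt0Pr => e e0.
    have [p [[pL _]]] := filter_ex (filterI Um (fnear y e e0)).
    by rewrite /= ler_norml => /andP[h1 h2]; have := pL.2 y; lra.
  apply/eqP; rewrite -subr_eq0 -normr_le0; apply/ler_addgt0Pr => e e0; rewrite add0r.
  have b1 : 0 < `|b| + 1 by rewrite ltr_wpDl.
  have d0 : 0 < e / (`|b| + 1) / 3 by rewrite !divr_gt0.
  have [p [[[pL _] h1] [h2 h3]]] := filter_ex (filterI
    (filterI Um (fnear (b *: x + y) _ d0)) (filterI (fnear x _ d0) (fnear y _ d0))).
  move: h1 h2 h3 => /=; rewrite pL.1 => h1 h2 h3.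
  have -> : f (b *: x + y) - (b * f x + f y) =
      - (b * p.1 x + p.1 y - f (b *: x + y)) + b * (p.1 x - f x) + (p.1 y - f y) by ring.
  apply: le_trans (ler_normD _ _) _; apply: le_trans (lerD (ler_normD _ _) h3) _.
  rewrite normrN normrM; set d := e / _ / 3 in d0 h1 h2 h3 *.
  have -> : e = 3 * d * (`|b| + 1) by rewrite /d; field; rewrite gt_eqF.
  have := ler_wpM2l (normr_ge0 b) h2; have := mulr_ge0 (normr_ge0 b) (ltW d0).
  by lra.
exists (f, a).
  split=> // y; apply/ler_addgt0Pr => e e0.
  have e2 : 0 < e / 2 by rewrite divr_gt0.
  have [p [[[_ pG] h1] h2]] := filter_ex (filterI (filterI Um (fnear y _ e2)) (anear _ e2)).
  move: h1 h2 (pG y); rewrite /= !ler_norml => /andP[? ?] /andP[? ?] ?; lra.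
have rel_lsc n e : 0 < e -> U [set p | rel_dist n f <= rel_dist n p.1 + e].
  move=> e0; have c0 := dist_scale_gt0 n.
  have ce : 0 < e * dist_scale n / 2 by rewrite divr_gt0// mulr_gt0.
  have [z [Zz z1] zn] : exists2 z, Z z /\ `|z| <= 1 &
      norm_over Z (f \- F n) - e * dist_scale n / 2 <= `|(f \- F n) z|.
    apply: contrapT => h.
    have : norm_over Z (f \- F n) <= norm_over Z (f \- F n) - e * dist_scale n / 2.
      apply: norm_over_le => // z Zz z1; rewrite leNgt; apply/negP => /ltW hz.
      by apply: h; exists z.
    by lra.
  apply: filterS (filterI Um (fnear z _ ce)) => p [[pL _] /= hp].
  rewrite /rel_dist ler_pdivrMr// mulrDl divfK ?gt_eqF//.
  have := le_norm_over (fun y => dist_scale_bound n y pL) Zz z1.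
  have : `|(f \- F n) z| <= `|(p.1 \- F n) z| + `|p.1 z - f z|.
    rewrite /= [`|p.1 z - f z|]distrC; apply: le_trans (ler_normD _ _).
    by rewrite le_eqVlt; apply/orP; left; apply/eqP; congr (`|_|); ring.
  by move: zn hp; lra.
have part_lsc K e : 0 < e -> U [set p | partial K f <= partial K p.1 + e].
  elim: K e => [|K IH] e e0.
    by apply: filterS Um => p _ /=; rewrite !geom_partial0 add0r ltW.
  have e2 : 0 < e / 2 by rewrite divr_gt0.
  pose d := Num.min 1 (e / 6).
  have d0 : 0 < d by rewrite lt_min ltr01 divr_gt0.
  have d1 : d <= 1 by rewrite ge_min lexx.
  have d6 : d <= e / 6 by rewrite ge_min lexx orbT.
  apply: filterS (filterI Um (filterI (IH _ e2) (rel_lsc K _ d0))) => p [[pL _] [/= h1 h2]].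
  rewrite !geom_partialS /=.
  have w0 : 0 <= 2^-1 * 2^-1 ^+ K :> R by rewrite mulr_ge0 ?exprn_ge0 ?invr_ge0.
  have w1 : 2^-1 * 2^-1 ^+ K <= 1 :> R.
    by rewrite -exprS exprn_ile1 ?invr_ge0// invf_le1//; lra.
  have := rel_dist_ge0 K fL; have := rel_dist_le1 K pL.
  move: h2 w0 w1; set w := 2^-1 * 2^-1 ^+ K; clearbody w.
  move: (rel_dist K f) (rel_dist K p.1) => x y h2 w0 w1 y1 x0.
  have : x ^+ 2 <= y ^+ 2 + e / 2 by nra.
  by move=> /(ler_wpM2l w0); nra.
have conv_lsc K : s * partial K f <= f v + a - regularized v.
  apply/ler_addgt0Pr => e e0.
  have e4 : 0 < e / 4 by rewrite divr_gt0.
  have es : 0 < e / 4 / s by rewrite divr_gt0.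
  have [p [[[mp h1] h2] [h3 h4]]] := filter_ex (filterI
    (filterI (UM _ e4) (part_lsc K _ es)) (filterI (fnear v _ e4) (anear _ e4))).
  move: h2 h3 h4 => /=; rewrite !ler_norml => h2 /andP[? ?] /andP[? ?].
  have := ler_wpM2l (ltW s_gt0) h2; rewrite mulrDr [s * (_ / s)]mulrC divfK ?gt_eqF//.
  have := ler_wpM2l (ltW s_gt0) (partial_le K mp.1); move: h1; rewrite /penalized_value.
  by lra.
rewrite /penalized_value /= lerBrDr -lerBrDl mulrC -ler_pdivlMr//.
by apply: (geom_sum_le half_gt0 sq_ge0 (K := 0)) => m; rewrite ler_pdivlMr// mulrC.
Qed.

(** The maximizer [f] at [v] is the derivative.  Some [F n] is close to [f] on
    [Z]; by [convexifier_mid] near-maximizers have almost the same distance to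
    this [F n], so they are close to [f], while minorants that are not
    near-maximizers at [v] do not matter at points near [v]. *)
Lemma regularized_superdiff v : exists xi, bounded_functional L xi /\
  forall e, 0 < e -> exists2 r, 0 < r &
    forall z, Z z -> `|z| <= r -> regularized (v + z) <= regularized v + xi z + e * `|z|.
Proof.
have [[f a] mf fv] := maximizer v; have fL := mf.1; rewrite /= in fL.
exists f; split=> // e e0.
have e3 : 0 < e / 3 by rewrite divr_gt0.
have [n fn] := F_dense (bounded_functional_dual fL) e3.
have c0 := dist_scale_gt0 n.
pose w : R := 2^-1 * 2^-1 ^+ n.
have w0 : 0 < w by rewrite mulr_gt0// exprn_gt0.
pose b := e / 3 / dist_scale n; have b0 : 0 < b by rewrite divr_gt0.
pose eta := s * w * b ^+ 2 / 2.
have eta0 : 0 < eta by rewrite divr_gt0// mulr_gt0 ?exprn_gt0// mulr_gt0.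
have fb : rel_dist n f <= b.
  rewrite ler_pM2r ?invr_gt0//; apply: norm_over_le => // z Zz z1.
  by apply: le_trans (fn z Zz) _; rewrite ler_piMr// ltW.
have close p : affine_minorant p -> regularized v - eta <= penalized_value p v ->
    forall z, Z z -> `|p.1 z - f z| <= e * `|z|.
  move=> mp pv; have pL := mp.1.
  have mm : affine_minorant (midpoint p.1 f, 2^-1 * (p.2 + a)).
    split=> [|y] /=; first exact: bounded_functional_mid.
    by rewrite /midpoint; have := mp.2 y; have := mf.2 y => /=; lra.
  have := penalized_value_le v mm; have := convexifier_mid n pL fL.
  move=> /(ler_wpM2l (ltW s_gt0)).
  move: fv pv; rewrite /penalized_value /midpoint /= -/w => fv pv h1 h2.
  have h3 : s * w * (2^-1 * (rel_dist n p.1 - rel_dist n f)) ^+ 2 <= 2^-1 * eta.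
    by lra.
  have h4 : (rel_dist n p.1 - rel_dist n f) ^+ 2 <= b ^+ 2.
    have sw : 0 < s * w by rewrite mulr_gt0.
    by rewrite -(ler_pM2l sw); move: h3; rewrite /eta; lra.
  have h5 : rel_dist n p.1 <= 2 * b.
    have h5 : rel_dist n p.1 - rel_dist n f <= b.
      rewrite leNgt; apply/negP => h5; move: h4; apply/negP; rewrite -ltNge.
      by rewrite ltrXn2r// ?(ltW b0).
    by lra.
  have h6 : norm_over Z (p.1 \- F n) <= 2 * (e / 3).
    by move: h5; rewrite /rel_dist ler_pdivrMr// /b mulrA divfK ?gt_eqF.
  move=> z Zz.
  have -> : p.1 z - f z = (p.1 z - F n z) - (f z - F n z) by ring.
  apply: le_trans (ler_normB _ _) _.
  have [K K0 FK] := dual_bounded_functional (F_dual n).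
  have ps : scalar (p.1 \- F n).
    by move=> t x y /=; rewrite pL.1 FK.1; ring.
  have := norm_overP Z_lin ps (fun y => dist_scale_bound n y pL) Zz => /= h7.
  have := ler_wpM2r (normr_ge0 z) h6; have := fn z Zz; lra.
exists (eta / (2 * L + 1)); first by rewrite divr_gt0// ltr_wpDl// mulr_ge0.
move=> z Zz; rewrite ler_pdivlMr ?ltr_wpDl ?mulr_ge0// => zr.
have [fs _] := fL; have [_ fN fD _] := scalarE fs.
apply: regularized_le => p mp; have [_ _ pD _] := scalarE mp.1.1.
have -> : penalized_value p (v + z) = penalized_value p v + p.1 z.
  by rewrite /penalized_value pD; ring.
have := bounded_functional_norm z fL; have := mp.1.2 z; have := penalized_value_le v mp.
rewrite ler_norml => h1 h2 /andP[h3 h4].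
have [pv|pv] := leP (regularized v - eta) (penalized_value p v).
  by have := close p mp pv z Zz; rewrite ler_norml => /andP[_]; lra.
have := mulr_ge0 (ltW e0) (normr_ge0 z); have := normr_ge0 z; lra.
Qed.

Lemma smooth_approximation : exists S : Y -> R,
  [/\ convexf S, forall x y, S y <= S x + L * `|y - x|,
      forall y, S y <= G y <= S y + s & forall v, superdiff Z S v].
Proof.
exists regularized; split; [exact: regularized_convex|exact: regularized_lip| |].
  by move=> y; rewrite regularized_le_G G_le_regularized.
move=> v e e0; have [xi [[xs _] h]] := regularized_superdiff v.
by exists xi; split=> //; exact: h.
Qed.

End Smoothing.

(** * Countable sets closed under choices, and minimization in a separable subspace *)

Section RichSets.
Context (R : realType) (Y : normedModType R).

Lemma closure_normP (S : set Y) z :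
  closure S z <-> forall e, 0 < e -> exists2 s, S s & `|z - s| < e.
Proof.
split=> [Sz e e0|Sz B /nbhs_ballP[e /= e0 eB]].
  have [s [Ss]] := Sz _ (nbhsx_ballx z e e0).
  by rewrite -ball_normE /= => zs; exists s.
have [s Ss zs] := Sz _ e0; exists s; split=> //; apply: eB.
by rewrite -ball_normE.
Qed.

Lemma closure_linear (S : set Y) : S 0 -> (forall x y, S x -> S y -> S (x + y)) ->
  (forall (q : rat) x, S x -> S (ratr q *: x)) -> linear_subset (closure S).
Proof.
move=> S0 SD SZ; split; first exact: subset_closure.
move=> a x y /closure_normP Sx /closure_normP Sy; apply/closure_normP => e e0.
have x1 : 0 < `|x| + 1 by rewrite ltr_wpDl.
have a2 : 0 < `|a| + 2 by rewrite ltr_wpDl.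
pose d := Num.min 1 (e / 3 / (`|x| + 1)).
have d0 : 0 < d by rewrite lt_min ltr01 !divr_gt0.
have d1 : d <= 1 by rewrite ge_min lexx.
have dx : d * (`|x| + 1) <= e / 3 by rewrite -ler_pdivlMr// ge_min lexx orbT.
have [q] : exists q, ratr q \in `]a, a + d[ by apply: rat_in_itvoo; rewrite ltrDl.
rewrite in_itv /= => /andP[aq qd].
have e3 : 0 < e / 3 by rewrite divr_gt0.
have [s Ss xs] := Sx (e / 3 / (`|a| + 2)) ltac:(by rewrite divr_gt0).
have [t St yt] := Sy _ e3.
exists (ratr q *: s + t); first exact: SD (SZ _ _ Ss) St.
have -> : a *: x + y - (ratr q *: s + t) =
    (a - ratr q) *: x + ratr q *: (x - s) + (y - t).
  by rewrite scalerBl scalerBr subrKA opprD addrACA.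
apply: le_lt_trans (ler_normD _ _) _; apply: le_lt_trans (lerD (ler_normD _ _) (lexx _)) _.
rewrite (normrZ (a - ratr q)) (normrZ (ratr q)).
have h1 : `|a - ratr q| <= d by rewrite distrC ger0_norm; lra.
have h2 : `|ratr q : R| <= `|a| + 1.
  rewrite -[ratr q](subrKC a); apply: le_trans (ler_normD _ _) _.
  by rewrite lerD2l distrC; lra.
have h3 : `|a - ratr q| * `|x| <= e / 3.
  by have := ler_wpM2r (normr_ge0 x) h1; have := normr_ge0 x; nra.
have h4 : `|ratr q : R| * `|x - s| <= e / 3.
  move: xs; rewrite ltr_pdivlMr// => xs.
  by have := ler_wpM2r (normr_ge0 (x - s)) h2; have := normr_ge0 (x - s); nra.
by lra.
Qed.

Lemma countable_setU T (A B : set T) : countable A -> countable B -> countable (A `|` B).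
Proof.
by move=> cA cB; rewrite -bigcup2E; apply: bigcup_countable => // -[|[|i]] _;
  rewrite /bigcup2 //=.
Qed.

(** The downward Löwenheim-Skolem argument: starting from [0] and [y0], sums,
    rational multiples and the supports of chosen witnesses are added
    countably many times. *)
Lemma rich_set (D : countType) (W : Type) (w0 : W) (P : D -> Y -> W -> Prop)
    (supp : W -> seq Y) (y0 : Y) :
  exists S : set Y, [/\ countable S, S 0, S y0,
    (forall x y, S x -> S y -> S (x + y)) /\
    (forall (q : rat) x, S x -> S (ratr q *: x)) &
    forall d v w, S v -> P d v w -> exists2 w', P d v w' & [set` supp w'] `<=` S].
Proof.
have /choice[pick pickP] : forall dv : D * Y, exists w, (exists w', P dv.1 dv.2 w') ->
    P dv.1 dv.2 w.
  move=> dv; have [[w Pw]|nw] := pselect (exists w', P dv.1 dv.2 w'); first by exists w.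
  by exists w0.
pose step (A : set Y) := A `|` [set xy.1 + xy.2 | xy in A `*` A] `|`
  [set ratr qx.1 *: qx.2 | qx in [set: rat] `*` A] `|`
  \bigcup_(dv in [set: D] `*` A) [set` supp (pick dv)].
pose A n := iter n step [set 0; y0].
have A_sub n : A n `<=` A n.+1 by move=> x Ax; left; left; left.
have A_mono n m : (n <= m)%N -> A n `<=` A m.
  elim: m => [|m IH]; first by rewrite leqn0 => /eqP ->.
  rewrite leq_eqVlt => /predU1P[->//|nm] x Ax; apply: A_sub; exact: IH.
exists (\bigcup_n A n); split.
- apply: bigcup_countable => // n _; elim: n => [|n IH].
    by apply: countable_setU; exact: countable1.
  apply: countable_setU; [apply: countable_setU; [apply: countable_setU => //|]|].
  + by apply: sub_countable (card_image_le _ _) _; exact: countableX.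
  + by apply: sub_countable (card_image_le _ _) _; exact: countableX.
  + apply: bigcup_countable => [|dv _]; first exact: countableX.
    by apply: finite_set_countable; exact: finite_seq.
- by exists 0%N => //; left.
- by exists 0%N => //; right.
- split=> [x y [n _ An] [m _ Am]|q x [n _ An]].
    exists (maxn n m).+1 => //; left; left; right; exists (x, y) => //; split.
      exact: A_mono (leq_maxl _ _) _ An.
    exact: A_mono (leq_maxr _ _) _ Am.
  by exists n.+1 => //; left; right; exists (q, x).
- move=> d v w [n _ An] Pw; exists (pick (d, v)); first by apply: (pickP (d, v)); exists w.
  by move=> u us; exists n.+1 => //; right; exists (d, v).
Qed.

End RichSets.

Section Fuzzy.
Context (R : realType) (Y : normedModType R) (Y_complete : is_complete Y).
Context (Z : set Y) (Z_lin : linear_subset Z) (Z_closed : closed Z).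
Context (F : nat -> Y -> R) (F_dual : forall n, dual Y (F n)).
Hypothesis F_dense : forall f e, dual Y f -> 0 < e -> exists n, near_on Z f (F n) e.

Local Notation superdiff := (superdiff Z).

Lemma superdiffD W1 W2 v : superdiff W1 v -> superdiff W2 v ->
  superdiff (fun y => W1 y + W2 y) v.
Proof.
move=> d1 d2 e e0; have e2 : 0 < e / 2 by rewrite divr_gt0.
have [x1 [s1 [r1 r10 h1]]] := d1 _ e2; have [x2 [s2 [r2 r20 h2]]] := d2 _ e2.
exists (fun y => x1 y + x2 y); split; first by move=> a x y; rewrite s1 s2; ring.
exists (Num.min r1 r2); first by rewrite lt_min r10.
move=> z Zz; rewrite le_min => /andP[z1 z2].
by have := h1 z Zz z1; have := h2 z Zz z2; lra.
Qed.

Lemma superdiffZ c W v : 0 <= c -> superdiff W v -> superdiff (fun y => c * W y) v.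
Proof.
move=> c0 d e e0; have c1 : 0 < c + 1 by rewrite ltr_wpDl.
have [xi [xs [r r0 h]]] := d _ (divr_gt0 e0 c1).
exists (fun y => c * xi y); split; first by move=> a x y; rewrite xs; ring.
exists r => // z Zz zr; have := ler_wpM2l c0 (h z Zz zr).
have h2 : c * (e / (c + 1)) <= e.
  by rewrite mulrA ler_pdivrMr// mulrC ler_wpM2l// ?(ltW e0)// lerDl.
by have := ler_wpM2r (normr_ge0 z) h2; lra.
Qed.

Lemma superdiff_geom_sum c0 (th : nat -> Y -> R) B v : 0 < c0 ->
  (forall k y, 0 <= th k y) -> (forall k x y, th k y <= th k x + `|y - x|) ->
  (forall k, th k 0 <= B) -> (forall k, superdiff (th k) v) ->
  superdiff (geom_sum c0 th) v.
Proof.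
move=> c00 th0 thL thB thd e e0; have e2 : 0 < e / 2 by rewrite divr_gt0.
have [K Ke] := geom_small (2 * c0) e2.
have part_diff : superdiff (geom_partial c0 th K) v.
  elim: K {Ke} => [|K IH].
    move=> d d0; exists (cst 0); split; first by move=> a x y; rewrite /cst; ring.
    by exists 1 => // z _ _; rewrite !geom_partial0 /cst !add0r mulr_ge0// ltW.
  have cK : 0 <= c0 * 2^-1 ^+ K by rewrite mulr_ge0 ?exprn_ge0 ?invr_ge0// ltW.
  have := superdiffD IH (superdiffZ cK (thd K)).
  by congr superdiff; apply/funext => y; rewrite geom_partialS.
have [xi [xs [r r0 h]]] := part_diff _ e2.
exists xi; split=> //; exists r => // z Zz zr.
have := geom_sum_diff c00 th0 thL thB K v (v + z); have := h z Zz zr.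
rewrite [v + z - v]addrAC subrr add0r mulrA.
by have := ler_wpM2r (normr_ge0 z) (ltW Ke); lra.
Qed.

(** A subgradient of [W] is squeezed between the values of [W] and any of the
    functionals given by [superdiff], for both [z] and [- z]. *)
Lemma superdiff_convex W (v : Y) : convexf W -> superdiff W v ->
  exists xi, [/\ scalar xi, forall y, xi y <= W (v + y) - W v &
    forall e, 0 < e -> exists2 r, 0 < r &
    forall z, Z z -> `|z| <= r -> W (v + z) <= W v + xi z + e * `|z|].
Proof.
move=> Wc Wd.
have [xi [xs xW]] := subgradient v Wc.
exists xi; split=> // e e0; have e2 : 0 < e / 2 by rewrite divr_gt0.
have [ze [zs [r r0 h]]] := Wd _ e2; exists r => // z Zz zr.
have Zn : Z (- z) by rewrite -scaleN1r; exact: linear_subsetZ.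
have := h (- z) Zn; rewrite normrN => /(_ zr); have := xW (- z); have := h z Zz zr.
have [_ xN _ _] := scalarE xs; have [_ zN _ _] := scalarE zs.
by rewrite xN zN; lra.
Qed.

(** [G] is replaced by a smooth approximation and the minimum over [Om] and [Z] of
    its sum with smooth gauges is attained at [v]; [xi] is a subgradient of this
    sum.  On the whole space [xi] is still an approximate subgradient of [G],
    because the approximations of [G] are uniform on the whole space. *)
Lemma fuzzy_on_subspace (Om : set Y) G L s c0 x1 : closed Om -> Om x1 -> Z x1 ->
  0 <= L -> 0 < s -> 0 < c0 ->
  convexf G -> (forall x y, G y <= G x + L * `|y - x|) ->
  (forall u, Om u -> G x1 <= G u) ->
  exists v xi, [/\ Om v, Z v, `|v - x1| <= 6 * (s / c0), scalar xi &
    (forall y, xi y <= G (v + y) - G v + s + 2 * c0 * `|y|) /\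
    forall e, 0 < e -> exists2 r, 0 < r &
      forall u, Om u -> Z u -> `|u - v| <= r -> - (e * `|u - v|) <= xi (u - v)].
Proof.
move=> Omcl Omx Zx L0 s0 c00 Gc GL Gmin.
pose nu (u y : Y) := `|y - u|.
have nuc u : convexf (nu u) by exact: dist_convex.
have nuL u x y : nu u y <= nu u x + 1 * `|y - x|.
  by rewrite mul1r; exact: dist_triangle.
have [H [Hc HL HE Hd]] := smooth_approximation Z_lin F_dual F_dense L0 s0 Gc GL.
have HG y : H y <= G y by have /andP[] := HE y.
have GH y : G y <= H y + s by have /andP[] := HE y.
have /choice[S SP] : forall ut : Y * R, exists S, 0 < ut.2 ->
    [/\ convexf S, forall x y, S y <= S x + 1 * `|y - x|,
      forall y, S y <= nu ut.1 y <= S y + ut.2 & forall v, superdiff S v].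
  move=> [u t]; have [t0|] := ltP 0 t; last first.
    by move=> t0; exists (cst 0).
  have [S SP] := smooth_approximation Z_lin F_dual F_dense ler01 t0 (nuc u) (nuL u).
  by exists S.
pose g u t y := S (u, t) y + t.
have gE u t y : 0 < t -> `|y - u| <= g u t y <= `|y - u| + t.
  by move=> t0; have [_ _ /(_ y)/andP[h1 h2] _] := SP (u, t) t0; rewrite /g lerD2r h2 h1.
have gL u t x y : 0 < t -> g u t y <= g u t x + `|y - x|.
  by move=> t0; have [_ /(_ x y) + _ _] := SP (u, t) t0; rewrite /g; lra.
have [|u [t [B [v [[Ov Zv] vx t0 gB vmin]]]]] := variational_principle Y_complete
    (closedI Omcl Z_closed) (conj Omx Zx) c00 s0 L0 HL _ gE gL.
  move=> w [Ow _]; apply: le_trans (HG _) _; apply: le_trans (Gmin _ Ow) _.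
  exact: GH.
pose th k := g (u k) (t k).
have th0 k y : 0 <= th k y by have /andP[+ _] := gE (u k) (t k) y (t0 k); exact: le_trans.
have thL k x y : th k y <= th k x + `|y - x| by exact: gL.
have thc k : convexf (th k).
  move=> x y a a0 a1; rewrite /th /g.
  by have [/(_ x y a a0 a1) + _ _ _] := SP (u k, t k) (t0 k); lra.
pose W y := H y + geom_sum c0 th y.
have Wc : convexf W.
  move=> x y a a0 a1; rewrite /W.
  have := Hc x y a a0 a1.
  have := geom_sum_convex c00 th0 thL gB thc x y a0 a1.
  by lra.
have Wd : superdiff W v.
  apply: superdiffD => //.
  apply: (superdiff_geom_sum c00 th0 thL gB) => k e e0.
  have [_ _ _ /(_ v e e0)[xi [xs [r r0 h]]]] := SP (u k, t k) (t0 k).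
  exists xi; split=> //; exists r => // z Zz zr.
  by have := h z Zz zr; rewrite /th /g; lra.
have [xi [xs xW xd]] := superdiff_convex Wc Wd.
exists v, xi; split=> //; split=> [y|e e0].
  apply: le_trans (xW y) _; rewrite /W.
  have := geom_sum_lip c00 th0 thL gB v (v + y).
  have := HG (v + y); have := GH v.
  rewrite [v + y - v]addrAC subrr add0r.
  by lra.
have [r r0 h] := xd e e0; exists r => // w Ow Zw wr.
have Zwv : Z (w - v).
  by rewrite addrC -scaleN1r; apply: Z_lin.2.
have := h _ Zwv wr; rewrite subrKC; have := vmin w (conj Ow Zw).
by rewrite -/th /W; lra.
Qed.

End Fuzzy.

(** * The approximate minimum principle in Asplund spaces *)

Section ProductSandwich.
Context (R : realType) (Y : normedModType R).

(** [sandwich] on [Y * Y] for the function [f (v + a) - f v + s + c |b|] of [(a, b)]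
    and the image of the cone in the diagonal.  The error [s] does not affect
    [psi], since a linear functional at most [c |.| + s] is at most [c |.|]. *)
Lemma subgradient_splitting (f : Y -> R) (L c s : R) (v : Y) (G : set (Y * R)) :
  convexf f -> (forall x y, f y <= f x + L * `|y - x|) -> 0 <= c -> 0 <= s ->
  G (0, 0) -> (forall a b, G a -> G b -> G (a + b)) ->
  (forall t a, 0 < t -> G a -> G (t *: a.1, t * a.2)) ->
  (forall a, G a -> f v <= f (v + a.1) + c * `|a.1| + a.2 + s) ->
  exists l psi : Y -> R, [/\ scalar l, scalar psi,
    forall y, l y <= f (v + y) - f v + s, forall y, psi y <= c * `|y| &
    forall a, G a -> 0 <= l a.1 + psi a.1 + a.2].
Proof.
move=> fc fL c0 s0 G0 GD GZ Gf.
pose p (x : Y * Y) := f (v + x.1) - f v + s + c * `|x.2|.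
pose GG := [set a : (Y * Y) * R | a.1.1 = a.1.2 /\ G (a.1.1, a.2)].
have [||||||l [ls lp lG]] := @sandwich R (Y * Y)%type p GG
    (fun x => L * `|x.1| + c * `|x.2|).
- move=> x y t t0 t1; rewrite /p /=.
  have := convexf_translate v 0 fc x.1 y.1 t0 t1.
  have := sublinear_convexf (@norm_sublinear _ Y) x.2 y.2 t0 t1.
  by move=> /(ler_wpM2l c0); lra.
- by [].
- move=> [[a1 a2] a3] [[b1 b2] b3] [/= -> Ga] [/= -> Gb]; split=> //=.
  exact: (GD _ _ Ga Gb).
- move=> t [[a1 a2] a3] t0 [/= -> Ga]; split=> //=.
  exact: (GZ t _ t0 Ga).
- move=> x w; rewrite /p /=.
  have := fL (v + (x.1 + w.1)) (v + w.1).
  have -> : v + w.1 - (v + (x.1 + w.1)) = - x.1.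
    by rewrite addrA [v + x.1]addrC -addrA opprD addrCA subrr addr0.
  rewrite normrN; have : `|w.2| <= `|x.2 + w.2| + `|x.2|.
    by rewrite -{1}[w.2](addKr x.2) addrC; apply: le_trans (ler_normB _ _) _.
  by move=> /(ler_wpM2l c0); lra.
- by move=> [[a1 a2] a3] [/= -> /Gf /=]; rewrite /p /=; lra.
have [l0 _ lD lZ] := scalarE ls.
exists (fun y => l (y, 0)), (fun y => l (0, y)); split.
- move=> a x y; rewrite -lZ -lD; congr l; congr pair.
  by rewrite /= scaler0 addr0.
- move=> a x y; rewrite -lZ -lD; congr l; congr pair.
  by rewrite /= scaler0 addr0.
- by move=> y; have := lp (y, 0); rewrite /p /= normr0 mulr0 addr0.
- move=> y; rewrite leNgt; apply/negP => h.
  pose d := l (0, y) - c * `|y|; have d0 : 0 < d by rewrite subr_gt0.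
  pose t := (s + 1) / d; have t0 : 0 < t by rewrite divr_gt0// ltr_wpDl.
  have := lp (t *: (0, y)); rewrite lZ /p /= scaler0 addr0 subrr add0r.
  rewrite normrZ (gtr0_norm t0).
  have : t * d = s + 1 by rewrite divfK// gt_eqF.
  by rewrite /d; lra.
- move=> [a1 a2] Ga /=; rewrite -lD.
  have := lG ((a1, a1), a2) (conj erefl Ga) => /=.
  suff -> : (a1, 0) + (0, a1) = (a1, a1) :> Y * Y by [].
  by congr pair; rewrite /= ?addr0 ?add0r.
Qed.

End ProductSandwich.

Section Combinations.
Context (R : realType) (Y : normedModType R) (f : Y -> R) (L c s : R).
Hypothesis f_lip : forall x y, f y <= f x + L * `|y - x|.
Hypothesis L_ge0 : 0 <= L.
Hypothesis c_ge0 : 0 <= c.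
Implicit Types (l : seq (nat * R * Y)) (v : Y).

(** A family [l] of triples [((m, t), u)] encodes the positive combination of the
    vectors [u - v] with coefficients [t]; the index [m] says that [u] is to
    count with an error [|u - v| / (m + 1)] in the definition of Fréchet
    normals. *)
Definition comb v l := \sum_(e <- l) e.1.2 *: (e.2 - v).
Definition cost v l := \sum_(e <- l) e.1.2 * (`|e.2 - v| / e.1.1.+1%:R).
Definition mass l := \sum_(e <- l) e.1.2.
(** A functional [xi <= f (v + .) - f v + c |.| + s] such that
    [- |u - v| / (m + 1) <= xi (u - v)] for all the members of the family shows
    that the excess is nonnegative, and by the Hahn-Banach theorem nonnegative
    excesses suffice for the existence of [xi]. *)
Definition excess v l := f (v + comb v l) - f v + c * `|comb v l| + cost v l + s.

Lemma comb_shift v v' l : comb v l = comb v' l + mass l *: (v' - v).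
Proof.
rewrite /comb /mass scaler_suml -big_split /=; apply: eq_bigr => e _.
by rewrite -scalerDr subrKA.
Qed.

Lemma cost_shift v v' l : (forall e, e \in l -> 0 <= e.1.2) ->
  cost v l <= cost v' l + mass l * `|v' - v|.
Proof.
move=> l0; rewrite /cost /mass mulr_suml -big_split /= !big_seq; apply: ler_sum => e el.
rewrite -mulrDr ler_wpM2l ?l0//.
have m0 : 0 < e.1.1.+1%:R :> R by [].
rewrite ler_pdivrMr// mulrDl divfK ?gt_eqF//.
have h : `|e.2 - v| <= `|e.2 - v'| + `|v' - v|.
  by rewrite -(subrKA v'); exact: ler_normD.
apply: le_trans h _; rewrite lerD2l ler_peMr//.
by rewrite (ler_nat _ 1).
Qed.

(** The centre [v] of the construction is only a limit of points of the countable
    set, so excesses have to be compared at different centres; the bound is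
    uniform as long as the total mass of the family is bounded. *)
Lemma excess_shift v v' l b : (forall e, e \in l -> 0 <= e.1.2) -> mass l <= b ->
  excess v l <= excess v' l + (2 * L + L * b + c * b + b) * `|v' - v|.
Proof.
move=> l0 lb; have m0 : 0 <= mass l by rewrite /mass big_seq; apply: sumr_ge0 => e /l0.
have b0 := le_trans m0 lb.
rewrite /excess; have h1 := f_lip (v' + comb v' l) (v + comb v l).
have h2 := f_lip v v'; have h3 := cost_shift v v' l0.
have nd : `|comb v l - comb v' l| <= b * `|v' - v|.
  rewrite (comb_shift v v') addrAC subrr add0r normrZ ger0_norm// ler_wpM2r//.
have h4 : `|comb v l| <= `|comb v' l| + b * `|v' - v|.
  rewrite -{1}(subrK (comb v' l) (comb v l)) addrC.
  by apply: le_trans (ler_normD _ _) _; rewrite lerD2l.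
have h5 : `|v + comb v l - (v' + comb v' l)| <= `|v' - v| + b * `|v' - v|.
  rewrite opprD addrACA; apply: le_trans (ler_normD _ _) _.
  by rewrite distrC lerD2l.
have h6 := ler_wpM2l L_ge0 h5; have h7 := ler_wpM2l c_ge0 h4.
have h8 := ler_wpM2r (normr_ge0 (v' - v)) lb.
by lra.
Qed.

Lemma combD v l l' : comb v (l ++ l') = comb v l + comb v l'.
Proof. by rewrite /comb big_cat. Qed.

Lemma costD v l l' : cost v (l ++ l') = cost v l + cost v l'.
Proof. by rewrite /cost big_cat. Qed.

Definition scale_family t l : seq (nat * R * Y) := [seq (e.1.1, t * e.1.2, e.2) | e <- l].

Lemma combZ v t l : comb v (scale_family t l) = t *: comb v l.
Proof.
by rewrite /comb big_map scaler_sumr; apply: eq_bigr => e _; rewrite scalerA.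
Qed.

Lemma costZ v t l : cost v (scale_family t l) = t * cost v l.
Proof.
by rewrite /cost big_map mulr_sumr; apply: eq_bigr => e _; rewrite /= mulrA.
Qed.

End Combinations.

Section AsplundFuzzy.
Context (R : realType) (Y : normedModType R) (Y_complete : is_complete Y).
Context (Y_asplund : asplund Y).

(** The predicate [P] describes families of points of [Om] with negative excess.
    It only involves countably many parameters, so [rich_set] provides [S] such
    that a family that exists at a centre in [S] also exists in [S].  At the
    point [v] given by [fuzzy_on_subspace] families in the closure of [S] have
    nonnegative excess, because of [xi]; by approximation of [v] by points of
    [S] all families of points close to [v] do. *)
Lemma asplund_fuzzy (Om : set Y) (f : Y -> R) (L c s c0 : R) (x1 : Y) :
  closed Om -> Om x1 -> 0 <= L -> 0 <= c -> 0 < s -> 0 < c0 -> convexf f ->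
  (forall x y, f y <= f x + L * `|y - x|) ->
  (forall u, Om u -> f x1 <= f u + c * `|u - x1|) ->
  exists v (l psi : Y -> R), [/\ Om v, `|v - x1| <= 6 * (s / c0), scalar l /\ scalar psi,
    (forall y, l y <= f (v + y) - f v + s) /\
    (forall y, psi y <= (c + 2 * c0) * `|y|) &
    forall e, 0 < e -> exists2 r, 0 < r &
      forall u, Om u -> `|u - v| < r -> - (e * `|u - v|) <= l (u - v) + psi (u - v)].
Proof.
move=> Omcl Omx L0 c_0 s0 c00 fc fL fmin.
pose c' := c + 2 * c0; have c'0 : 0 <= c' by rewrite addr_ge0// mulr_ge0// ltW.
pose G y := f y + c * `|y - x1|.
have GL x y : G y <= G x + (L + c) * `|y - x|.
  by rewrite /G; have := fL x y; have := ler_wpM2l c_0 (dist_triangle x y x1); lra.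
have Gc : convexf G.
  move=> x y t t0 t1; rewrite /G.
  have := dist_convex x1 x y t0 t1.
  by move=> /(ler_wpM2l c_0); have := fc x y t t0 t1; lra.
have Gmin u : Om u -> G x1 <= G u.
  by move=> Ou; rewrite /G subrr normr0 mulr0 addr0; exact: fmin.
pose exc := excess f c' s.
pose P (d : seq nat * nat * nat) (v : Y) (w : seq (nat * R * Y)) :=
  [/\ forall e, e \in w -> [/\ (e.1.1 < size d.1.1)%N, 0 <= e.1.2, Om e.2 &
         `|e.2 - v| < 3 / 4 / (nth 0%N d.1.1 e.1.1).+1%:R],
      mass w <= d.2%:R & exc v w <= - (2 / d.1.2.+1%:R)].
have [S [Sc S0 Sx [SD SZ] SP]] := @rich_set R Y _ _ [::] P (map snd) x1.
pose Z := closure S.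
have Z_lin := closure_linear S0 SD SZ.
have [F [F_dual F_dense]] := separable_dual Y_asplund Sc S0 (@subset_closure _ S) Z_lin
  (fun z e Zz e0 => (closure_normP S z).1 Zz e e0).
have Lc0 : 0 <= L + c by rewrite addr_ge0.
have [v [xi [Ov Zv vx xs [xG xd]]]] := fuzzy_on_subspace Y_complete Z_lin
  (@closed_closure _ S) F_dual F_dense Omcl Omx (subset_closure Sx) Lc0 s0 c00 Gc GL Gmin.
have xf y : xi y <= f (v + y) - f v + s + c' * `|y|.
  apply: le_trans (xG y) _; rewrite /G /c'.
  have := dist_triangle v (v + y) x1; rewrite [v + y - v]addrAC subrr add0r.
  by move=> /(ler_wpM2l c_0); lra.
have /choice[k kP] : forall m : nat, exists k : nat, forall u, Om u -> Z u ->
    `|u - v| < k.+1%:R^-1 -> - (`|u - v| / m.+1%:R) <= xi (u - v).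
  move=> m; have [|r r0 h] := xd m.+1%:R^-1; first by rewrite invr_gt0.
  exists (Num.truncn r^-1) => u Ou Zu ur; rewrite mulrC; apply: h => //.
  apply: le_trans (ltW ur) _; rewrite -[leRHS]invrK lef_pV2 ?posrE ?invr_gt0//.
  by apply: ltW; exact: truncnS_gt.
pose valid (w : seq (nat * R * Y)) := forall e, e \in w -> [/\ 0 <= e.1.2, Om e.2 &
  `|e.2 - v| < 1 / 2 / (k e.1.1).+1%:R].
have exc_ge0 (w : seq (nat * R * Y)) : valid w -> 0 <= exc v w.
  move=> wv; rewrite leNgt; apply/negP => neg.
  have w0 (e : nat * R * Y) : e \in w -> 0 <= e.1.2 by move=> /wv[].
  have [q q3] : exists q : nat, exc v w <= - (3 / q.+1%:R).
    exists (Num.truncn (3 / - exc v w)).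
    rewrite lerNr ler_pdivrMr// mulrC -ler_pdivrMr ?oppr_gt0//.
    by apply: ltW; exact: truncnS_gt.
  have [b wb] : exists b : nat, mass w <= b%:R.
    by exists (Num.truncn (mass w)).+1; apply: ltW; exact: truncnS_gt.
  have [M wM] : exists M, forall e, e \in w -> (e.1.1 < M)%N.
    exists (\max_(e <- w) e.1.1).+1 => e ew; rewrite ltnS.
    exact: (leq_bigmax_seq (F := fun e : nat * R * Y => e.1.1) e ew isT).
  pose ks := mkseq k M.
  pose C := 2 * L + L * b%:R + c' * b%:R + b%:R + 1.
  have C0 : 0 < C by rewrite ltr_wpDl// !addr_ge0// !mulr_ge0.
  (* Radii are [1/2], [3/4] and [1] times [1 / (k m + 1)] for the given family, for
     the family at the centre [v'] and for [kP]; the quarters are for [|v - v'|]. *)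
  have [d d0 dk] : exists2 d : R, 0 < d & forall m, (m < M)%N -> d <= 1 / 4 / (k m).+1%:R.
    elim: (M) => [|m [d d0 dm]]; first by exists 1.
    exists (Num.min d (1 / 4 / (k m).+1%:R)); first by rewrite lt_min d0/= !divr_gt0.
    move=> m'; rewrite ltnS leq_eqVlt => /predU1P[->|/dm h].
      by rewrite ge_min lexx orbT.
    by rewrite ge_min h.
  have q0 : 0 < q.+1%:R^-1 :> R by rewrite invr_gt0.
  pose d' := Num.min d (q.+1%:R^-1 / C).
  have d'0 : 0 < d' by rewrite lt_min d0/= divr_gt0.
  have [v' Sv' vv'] := (closure_normP S v).1 Zv _ d'0.
  have vd : `|v - v'| < d by apply: lt_le_trans vv' _; rewrite ge_min lexx.
  have vC : C * `|v - v'| <= q.+1%:R^-1.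
    rewrite mulrC -ler_pdivlMr//; apply: le_trans (ltW vv') _.
    by rewrite ge_min lexx orbT.
  have shift x y (w' : seq (nat * R * Y)) : `|y - x| = `|v - v'| ->
      (forall e, e \in w' -> 0 <= e.1.2) -> mass w' <= b%:R ->
      exc x w' <= exc y w' + q.+1%:R^-1.
    move=> xy h1 h2; apply: le_trans (excess_shift s fL L0 c'0 x y h1 h2) _.
    rewrite lerD2l; apply: le_trans vC; rewrite xy ler_wpM2r// /C lerDl.
    exact: ler01.
  have Pw : P (ks, q, b) v' w.
    split=> //=.
      move=> e ew; have [e0 Oe ev] := wv e ew; split=> //.
        by rewrite size_mkseq wM.
      rewrite nth_mkseq ?wM//; apply: le_lt_trans (dist_triangle v _ _) _.
      have := dk _ (wM _ ew); have := vd; move: ev.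
      set t := (k e.1.1).+1%:R^-1; move=> *; lra.
    have := shift v' v w erefl w0 wb.
    by move: q3; move: (q.+1%:R^-1) (exc v w) (exc v' w) => t a1 a2; lra.
  have [w' [w'P w'b w'e] w'S] := SP _ _ _ Sv' Pw; rewrite /= in w'P w'b w'e.
  have w'0 (e : nat * R * Y) : e \in w' -> 0 <= e.1.2 by move=> /w'P[].
  have : exc v w' < 0.
    apply: le_lt_trans (shift v v' w' (distrC _ _) w'0 w'b) _.
    by move: w'e q0; move: (q.+1%:R^-1) (exc v' w') => t a; lra.
  apply/negP; rewrite -leNgt.
  rewrite /exc /excess.
  suff : - cost v w' <= xi (comb v w') by have := xf (comb v w'); lra.
  have [xi0 _ xiD xiZ] := scalarE xs.
  have -> : xi (comb v w') = \sum_(e <- w') e.1.2 * xi (e.2 - v).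
    rewrite /comb; elim: (w') => [|e w'' IH]; first by rewrite !big_nil.
    by rewrite !big_cons xiD xiZ IH.
  rewrite /cost -sumrN !big_seq; apply: ler_sum => e ew.
  have [em e0 Oe ev] := w'P e ew; rewrite -mulrN ler_wpM2l//.
  rewrite size_mkseq in em; rewrite nth_mkseq// in ev.
  apply: kP => //; first by apply: subset_closure; apply: w'S; apply: map_f.
  apply: le_lt_trans (dist_triangle v' _ _) _; rewrite [`|v' - v|]distrC.
  have := dk _ em; move: vd ev.
  by set t := (k e.1.1).+1%:R^-1; move=> *; lra.
pose Gam := [set a : Y * R | exists2 w, valid w & a = (comb v w, cost v w)].
have [|||| l [psi [ls ps lf pc lG]]] :=
  @subgradient_splitting R Y f L c' s v Gam fc fL c'0 (ltW s0).
- by exists [::] => //; rewrite /comb /cost !big_nil.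
- move=> _ _ [w wv ->] [w' wv' ->]; exists (w ++ w').
    by move=> e; rewrite mem_cat => /orP[/wv|/wv'].
  by rewrite combD costD.
- move=> t _ t0 [w wv ->]; exists (scale_family t w).
    move=> _ /mapP[e /wv[e0 Oe ev] ->]; split=> //=.
    by rewrite mulr_ge0// ltW.
  by rewrite combZ costZ.
- move=> _ [w wv ->] /=; have := exc_ge0 w wv.
  by rewrite /exc /excess; lra.
exists v, l, psi; split=> // e e0.
pose m := Num.truncn e^-1.
have me : m.+1%:R^-1 <= e.
  rewrite -[leRHS]invrK lef_pV2 ?posrE ?invr_gt0//.
  by apply: ltW; exact: truncnS_gt.
exists (1 / 2 / (k m).+1%:R); first by rewrite !divr_gt0.
move=> u Ou ur.
have := lG (comb v [:: (m, 1, u)], cost v [:: (m, 1, u)]).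
rewrite /comb /cost !big_seq1 /= scale1r mul1r => /(_ _) h.
have := ler_wpM2r (normr_ge0 (u - v)) me; rewrite mulrC => h2.
suff /h : Gam (u - v, `|u - v| / m.+1%:R) by move: h2; move: (m.+1%:R^-1) => t; lra.
exists [:: (m, 1, u)]; last by rewrite /comb /cost !big_seq1 /= scale1r mul1r.
by move=> e'; rewrite inE => /eqP -> /=.
Qed.

End AsplundFuzzy.

(** * Normal cones at minimizers, and the Ekeland principle *)

Section NormalCones.
Context (R : realType) (Y : normedModType R).

Lemma clarke_tangent_cone0 (A : set Y) x : clarke_tangent_cone Y A x 0.
Proof.
move=> y_ t_ yx Ay t0 tc; exists (cst 0); split; first exact: cvg_cst.
by move=> k; rewrite /cst scaler0 addr0.
Qed.

(** The sequence [y_ k + t_ k z_ k] lies in [A] and also tends to [x], so the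
    second tangent vector can be used along it. *)
Lemma clarke_tangent_coneD (A : set Y) x z w : clarke_tangent_cone Y A x z ->
  clarke_tangent_cone Y A x w -> clarke_tangent_cone Y A x (z + w).
Proof.
move=> Tz Tw y_ t_ yx Ay t0 tc.
have [z_ [zc zA]] := Tz y_ t_ yx Ay t0 tc.
have yzx : (fun k => y_ k + t_ k *: z_ k) @ \oo --> x.
  rewrite -[x]addr0 -[X in _ + X](scale0r z); apply: cvgD => //.
  exact: cvgZ.
have [w_ [wc wA]] := Tw _ t_ yzx zA t0 tc.
exists (fun k => z_ k + w_ k); split; first exact: cvgD.
by move=> k; rewrite scalerDr addrA.
Qed.

Lemma clarke_tangent_coneZ (A : set Y) x t z : 0 < t -> clarke_tangent_cone Y A x z ->
  clarke_tangent_cone Y A x (t *: z).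
Proof.
move=> t0 Tz y_ t_ yx Ay t_0 tc.
have tt0 k : 0 < t_ k * t by rewrite mulr_gt0.
have ttc : (fun k => t_ k * t) @ \oo --> (0 : R).
  by rewrite -(mul0r t); apply: cvgM => //; exact: cvg_cst.
have [z_ [zc zA]] := Tz y_ _ yx Ay tt0 ttc.
exists (fun k => t *: z_ k); split; first by apply: cvgZr.
by move=> k; rewrite scalerA.
Qed.

(** Along points [x + t w] of [A] with [w] close to [z] the minimality of [x] gives
    the inequality for [t z], up to an error that is small compared with [t];
    convexity of [f] carries it from [t z] to [z]. *)
Lemma clarke_minimum (A : set Y) (f : Y -> R) L c x z : A x -> convexf f -> 0 <= L ->
  0 <= c -> (forall x y, f y <= f x + L * `|y - x|) ->
  (forall u, A u -> f x <= f u + c * `|u - x|) ->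
  clarke_tangent_cone Y A x z -> f x <= f (x + z) + c * `|z|.
Proof.
move=> Ax fc L0 c0 fL fmin Tz.
have [z_ [zz zA]] := Tz (cst x) (fun k => k.+1%:R^-1) (cvg_cst _) (fun=> Ax)
  ltac:(by move=> k; rewrite invr_gt0) (@cvg_harmonic R).
apply/ler_addgt0Pr => e e0.
have e1 : 0 < e / (L + c + 1) by rewrite divr_gt0// ltr_wpDl// addr_ge0.
have /cvgrPdist_le/(_ _ e1)[N _ /(_ N (leqnn N))] := zz.
rewrite /=; pose t : R := N.+1%:R^-1; have := zA N; rewrite /cst -/t.
set w := z_ N => Aw zw.
have t0 : 0 < t by rewrite invr_gt0.
have t1 : t <= 1 by rewrite invf_le1// ler1n.
have := fmin _ Aw; rewrite [x + t *: w - x]addrAC subrr add0r => h1.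
have := fL (x + t *: z) (x + t *: w).
have -> : x + t *: w - (x + t *: z) = t *: (w - z).
  by rewrite opprD addrACA subrr add0r scalerBr.
rewrite normrZ (gtr0_norm t0) => h2.
have := fc (x + z) x t (ltW t0) t1.
have -> : t *: (x + z) + (1 - t) *: x = x + t *: z.
  by rewrite scalerDr addrAC -scalerDl subrKC scale1r.
move=> h3; rewrite normrZ (gtr0_norm t0) in h1.
have h4 : `|w| <= `|z| + `|w - z|.
  by rewrite -{1}(subrKC z w); exact: ler_normD.
rewrite distrC in zw; have h5 : (L + c) * `|w - z| <= e.
  move: zw; rewrite ler_pdivlMr ?ltr_wpDl ?addr_ge0// mulrC => h.
  by have := normr_ge0 (w - z); lra.
have h6 := ler_wpM2l c0 h4.
rewrite -subr_ge0 -(pmulr_rge0 _ t0).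
have h7 : c * (t * `|w|) <= t * (c * `|z| + c * `|w - z|).
  by rewrite mulrCA ler_pM2l//; lra.
have h8 := ler_wpM2l (ltW t0) h5.
by lra.
Qed.

Lemma frechet_normal_coneI (A : set Y) v f : dual Y f ->
  (forall e, 0 < e -> exists2 r, 0 < r &
     forall u, A u -> `|u - v| < r -> f (u - v) <= e * `|u - v|) ->
  frechet_normal_cone Y A v f.
Proof.
move=> fd fe; split=> //; apply/lee_addgt0Pr => e e0; rewrite add0e.
have [r r0 rP] := fe e e0.
rewrite limf_esupE; apply: (@le_trans _ _ (ereal_sup
  ((fun z : Y => (f (z - v) / `|z - v|)%:E) @` [set u | [/\ A u, u != v & `|u - v| < r]]))).
  apply: ereal_inf_lbound; exists [set u | [/\ A u, u != v & `|u - v| < r]] => //.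
  rewrite /within /= /dnbhs /within /=.
  apply/nbhs_ballP; exists r => // u; rewrite -ball_normE /= => uv uv0 Au; split=> //.
  by rewrite distrC.
apply: ge_ereal_sup => _ [u [Au uv0 uvr] <-]; rewrite lee_fin.
by rewrite ler_pdivrMr ?normr_gt0 ?subr_eq0//; exact: rP.
Qed.

End NormalCones.

Section Ekeland.
Context (R : realType) (Y : normedModType R) (Y_complete : is_complete Y).

(** The sharp bound on the distance comes from adding [c1 |. - w|] with [c1] close
    to [eps / delta] first; [variational_principle] then perturbs only slightly
    a near-minimizer [u1] of the sum. *)
Lemma ekeland (A : set Y) (f : Y -> R) (L I eps delta : R) (w : Y) :
  closed A -> A w -> 0 <= L -> 0 < eps -> 0 < delta ->
  (forall x y, f y <= f x + L * `|y - x|) ->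
  (forall u, A u -> I <= f u) -> f w < I + eps ->
  exists x c, [/\ A x, `|x - w| < delta, 0 <= c, c < eps / delta &
    forall u, A u -> f x <= f u + c * `|u - x|].
Proof.
move=> Acl Aw L0 e0 d0 fL fI fw.
have Iw := fI _ Aw.
pose e1 := (f w - I + eps) / 2; pose c1 := e1 / delta.
have e10 : 0 < e1 by rewrite divr_gt0//; lra.
have c10 : 0 < c1 by rewrite divr_gt0.
have c1e : c1 < eps / delta by rewrite ltr_pM2r ?invr_gt0// /e1; lra.
pose d1 := (f w - I) / c1.
have d1d : d1 < delta.
  have : c1 * delta = e1 by rewrite divfK// gt_eqF.
  by rewrite ltr_pdivrMr// mulrC => ->; rewrite /e1; lra.
pose c0 := (eps / delta - c1) / 4.
have c00 : 0 < c0 by rewrite divr_gt0// subr_gt0.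
pose e := c0 * (delta - d1) / 12.
have e00 : 0 < e by rewrite divr_gt0// mulr_gt0// subr_gt0.
pose H y := f y + c1 * `|y - w|.
have HL x y : H y <= H x + (L + c1) * `|y - x|.
  by rewrite /H; have := fL x y; have := ler_wpM2l (ltW c10) (dist_triangle x y w); lra.
have [u1 [Au1 Hu1 Hmin]] : exists u1, [/\ A u1, H u1 <= H w &
    forall u, A u -> H u1 <= H u + e].
  have hi : has_inf [set H u | u in A].
    split; first by exists (H w), w.
    exists I => _ [u Au <-]; have := fI u Au.
    by have := mulr_ge0 (ltW c10) (normr_ge0 (u - w)); rewrite /H; lra.
  have [_ [u Au <-] ult] := inf_adherent e00 hi.
  have uP u' : A u' -> H u <= H u' + e.
    move=> Au'; apply: le_trans (ltW ult) _; rewrite lerD2r.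
    by apply: ge_inf; [case: hi|exists u'].
  have [Huw|Hwu] := leP (H u) (H w); first by exists u.
  exists w; split=> // u' Au'; apply: le_trans (uP _ Au'); exact: ltW.
have u1w : `|u1 - w| <= d1.
  rewrite ler_pdivlMr// mulrC; have := fI _ Au1.
  by move: Hu1; rewrite /H subrr normr0 mulr0; lra.
have Lc : 0 <= L + c1 by rewrite addr_ge0// ltW.
have [u [s [B [v [Av vu s0 gB vmin]]]]] := variational_principle Y_complete
   (g := fun u s y => `|y - u|) Acl Au1 c00 e00 Lc HL Hmin
   ltac:(by move=> a s y s0; rewrite lexx lerDl ltW)
   ltac:(by move=> a s x y _; exact: dist_triangle).
exists v, (c1 + 2 * c0); split=> //.
- rewrite -(subrKA u1); apply: le_lt_trans (ler_normD _ _) _.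
  have ec : 6 * (e / c0) = (delta - d1) / 2 by rewrite /e; field; rewrite gt_eqF.
  by move: vu; rewrite ec; lra.
- by apply: addr_ge0; [exact: ltW|apply: mulr_ge0 => //; exact: ltW].
- by rewrite /c0; move: c1e; lra.
move=> x Ax; have := vmin x Ax.
have := geom_sum_lip c00 (fun k y => normr_ge0 (y - u k))
  (fun k x y => dist_triangle x y (u k)) gB v x.
by rewrite /H; have := ler_wpM2l (ltW c10) (dist_triangle v x w); lra.
Qed.

End Ekeland.

(** * Dual norms and the map of differences *)

Section UniformBoundedness.
Context (R : realType) (Y : normedModType R) (Y_complete : is_complete Y).

Let Yc : completeNormedModType R :=
  HB.pack (NormedModule.sort Y) (Uniform_isComplete.Build Y Y_complete).

(** A seminorm that is a supremum of continuous functionals is bounded, by the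
    uniform boundedness principle. *)
Lemma complete_seminorm_bounded (q : Y -> R) (F : set (Y -> R)) :
  (forall f, F f -> dual Y f) -> (forall f y, F f -> `|f y| <= q y) ->
  (forall y, exists2 f, F f & f y = q y) ->
  exists2 L, 0 <= L & forall y, q y <= L * `|y|.
Proof.
move=> Fd Fq qF.
have [||M MP] := @Banach_Steinhauss R Yc R^o F _ _ 1.
- move=> f /Fd fd; split; last by case: fd.
  have [L L0 fL] := dual_bounded_functional fd => r; exists (L * r) => x xr.
  apply: le_trans (bounded_functional_norm x fL) _.
  by rewrite ler_wpM2l// ltW.
- by move=> x; exists (q x) => f; exact: Fq.
exists `|M| => // y; have [f Ff <-] := qF y.
have [f0 _ _ fZ] := scalarE (Fd _ Ff).1.
have [->|y0] := eqVneq y 0; first by rewrite f0 normr0 mulr0.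
have ny : 0 < `|y| by rewrite normr_gt0.
have := MP f Ff (`|y|^-1 *: y).
rewrite fZ normrZ normfV normr_id mulVf ?gt_eqF// => /(_ (lexx _)).
rewrite normrM normfV normr_id mulrC ler_pdivrMr// => h.
apply: le_trans (ler_norm _) _; apply: le_trans h _.
by rewrite ler_wpM2r// ler_norm.
Qed.

End UniformBoundedness.

Section DualNorm.
Context (R : realType) (Y : normedModType R).

Lemma dual_norm_over (f : Y -> R) : dual_norm Y f = norm_over setT f.
Proof. by congr (sup (image _ _)); apply/seteqP; split=> [z|z []]. Qed.

Lemma linear_subsetT : linear_subset [set: Y]. Proof. by []. Qed.

Lemma dual_norm_le (f : Y -> R) b : 0 <= b -> (forall y, `|f y| <= b * `|y|) ->
  dual_norm Y f <= b.
Proof.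
move=> b0 fb; rewrite dual_norm_over; apply: norm_over_le; first exact: linear_subsetT.
by move=> z _ z1; apply: le_trans (fb z) _; rewrite ler_piMr.
Qed.

Lemma dual_normP (f : Y -> R) y : dual Y f -> `|f y| <= dual_norm Y f * `|y|.
Proof.
move=> fd; have [L L0 fL] := dual_bounded_functional fd.
rewrite dual_norm_over; apply: (norm_overP linear_subsetT fL.1) => // z.
exact: (bounded_functional_norm z fL).
Qed.

Lemma dual_norm_ge0 (f : Y -> R) : 0 <= dual_norm Y f.
Proof.
rewrite /dual_norm; set B := [set `|f y| | y in _].
have [hs|hs] := pselect (has_sup B).
  apply: le_trans (normr_ge0 (f 0)) _; apply: sup_upper_bound => //.
  by exists 0 => //=; rewrite normr0.
by rewrite sup_out.
Qed.

Lemma dual_dist_le (f g : Y -> R) C : C g -> dual_dist Y f C <= dual_norm Y (f \- g).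
Proof.
move=> Cg; apply: ge_inf; last by exists g.
by exists 0 => _ [h _ <-]; exact: dual_norm_ge0.
Qed.

Lemma dual_normZ (f : Y -> R) t : 0 <= t -> dual Y f ->
  dual_norm Y (fun y => t * f y) = t * dual_norm Y f.
Proof.
move=> t0 fd; apply/eqP; rewrite eq_le; apply/andP; split.
  apply: dual_norm_le => [|y]; first by rewrite mulr_ge0// dual_norm_ge0.
  by rewrite normrM ger0_norm// -mulrA ler_wpM2l// dual_normP.
have [<-|t0'] := eqVneq 0 t; first by rewrite mul0r dual_norm_ge0.
have {t0 t0'}t0 : 0 < t by rewrite lt_neqAle t0'.
have td : dual Y (fun y => t * f y).
  have [L L0 [fs fL]] := dual_bounded_functional fd.
  apply: (@bounded_functional_dual _ _ (t * L)); split.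
    by move=> a x y; rewrite fs; ring.
  by move=> y; rewrite -mulrA ler_pM2l.
rewrite mulrC -ler_pdivlMr//; apply: dual_norm_le.
  by rewrite divr_ge0 ?dual_norm_ge0// ltW.
move=> y; have := dual_normP y td; rewrite normrM gtr0_norm//.
by rewrite mulrC -ler_pdivlMr// mulrAC.
Qed.

Lemma norm_subgradient (x : Y) : exists f : Y -> R, [/\ scalar f,
  forall y, f y <= `|y| & f x = `|x|].
Proof.
have [f [fs fx]] := subgradient x (sublinear_convexf (@norm_sublinear _ Y)).
have [_ fN _ _] := scalarE fs.
have fle y : f y <= `|y| by apply: le_trans (fx y) _; have := ler_normD x y; lra.
exists f; split=> //; apply/eqP; rewrite eq_le fle /=.
by have := fx (- x); rewrite fN subrr normr0; lra.
Qed.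

End DualNorm.

Section Differences.
Context (R : realType) (n : nat) (n_gt1 : (1 < n)%N) (X : lmodType R).

Definition differences (u : {ffun 'I_n -> X}) : {ffun 'I_n.-1 -> X} :=
  [ffun i => u (init_idx i) - u (last_idx n_gt1)].

(** A right inverse of [differences], with zero last coordinate. *)
Definition pad (w : {ffun 'I_n.-1 -> X}) : {ffun 'I_n -> X} :=
  [ffun j => if insub (val j) is Some i then w i else 0].

(** The adjoint of [differences]: the functional on the last coordinate makes
    the components add up to zero. *)
Definition adjoint (xs : 'I_n.-1 -> X -> R) (j : 'I_n) : X -> R :=
  if insub (val j) is Some i then xs i else fun x => - \sum_i xs i x.

Lemma insub_init (i : 'I_n.-1) : insub (val (init_idx i)) = Some i.
Proof. by rewrite -[RHS](valK i). Qed.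

Lemma insub_last : insub (val (last_idx n_gt1)) = None :> option 'I_n.-1.
Proof. by rewrite insubF //= ltnn. Qed.

Lemma sum_init_last (V : nmodType) (F : 'I_n -> V) :
  \sum_j F j = \sum_(i < n.-1) F (init_idx i) + F (last_idx n_gt1).
Proof.
move: n_gt1 F; case: n => [//|m] m1 F; rewrite big_ord_recr /=; congr (_ + F _).
  by apply: eq_bigr => i _; congr F; exact: val_inj.
exact: val_inj.
Qed.

Lemma differences_linear a u v :
  differences (a *: u + v) = a *: differences u + differences v.
Proof. by apply/ffunP => i; rewrite !ffunE scalerBr opprD addrACA. Qed.

Lemma differencesB u v : differences (u - v) = differences u - differences v.
Proof. by have := differences_linear (-1) v u; rewrite !scaleN1r ![- _ + _]addrC. Qed.

Lemma differencesD u v : differences (u + v) = differences u + differences v.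
Proof. by have := differences_linear 1 u v; rewrite !scale1r. Qed.

Lemma differences0 : differences 0 = 0.
Proof. by apply/ffunP => i; rewrite !ffunE subrr. Qed.

Lemma differencesZ a u : differences (a *: u) = a *: differences u.
Proof. by have := differences_linear a u 0; rewrite !addr0 differences0 addr0. Qed.

Lemma differences_pad w : differences (pad w) = w.
Proof. by apply/ffunP => i; rewrite !ffunE insub_init insub_last subr0. Qed.

Lemma pad_linear a u v : pad (a *: u + v) = a *: pad u + pad v.
Proof.
apply/ffunP => j; rewrite !ffunE; case: insub => [i|]; first by rewrite !ffunE.
by rewrite scaler0 addr0.
Qed.

Lemma adjoint_init xs i : adjoint xs (init_idx i) = xs i.
Proof. by rewrite /adjoint insub_init. Qed.

Lemma sum_adjoint xs : \sum_j adjoint xs j = 0.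
Proof.
rewrite sum_init_last; apply/funext => x /=; rewrite fctE.
rewrite /adjoint insub_last; rewrite [X in X + _](_ : _ = \sum_i xs i x) ?subrr//.
by rewrite fct_sumE; apply: eq_bigr => i _; rewrite insub_init.
Qed.

Lemma pairing_adjoint xs u : (forall i, scalar (xs i)) ->
  pairing (adjoint xs) u = pairing xs (differences u).
Proof.
move=> xss; rewrite /pairing sum_init_last /adjoint insub_last -sumrB.
apply: eq_bigr => i _; rewrite insub_init ffunE.
by have [_ xN xD _] := scalarE (xss i); rewrite xD xN.
Qed.

Lemma adjoint_in (D : set (X -> R)) xs : functional_space D ->
  (forall i, D (xs i)) -> forall j, D (adjoint xs j).
Proof.
move=> [_ D0 DD] xsD j; rewrite /adjoint; case: insub => [//|].
have : D (fun x => \sum_i xs i x).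
  have -> : (fun x => \sum_i xs i x) = \sum_i xs i.
    by apply/funext => x; rewrite fct_sumE.
  elim/big_ind : _ => [||i _]; [exact: D0| |exact: xsD].
  move=> f g Df Dg; have -> : f + g = (fun x => 1 * f x + g x).
    by apply/funext => x; rewrite mul1r.
  exact: DD.
move=> /(DD (-1) _ _)/(_ D0); congr D.
by apply/funext => x; rewrite /cst addr0 mulN1r.
Qed.

End Differences.

(** * From subgradients to tuples of functionals *)

Section Multipliers.
Context (R : realType) (n : nat) (n_gt1 : (1 < n)%N) (X : lmodType R).
Context (N : norm_on {ffun 'I_n.-1 -> X}) (Np : norm_on {ffun 'I_n -> X}).
Context (Xd : set (X -> R)) (Xd_space : functional_space Xd).
Context (dual_N : dual_is_power N Xd) (dual_Np : dual_is_power Np Xd).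

Local Notation A := (@differences R n n_gt1 X).

Let normE (w : normed N) : `|w| = N w. Proof. by []. Qed.

(** This is where both dual spaces are powers of the same space [Xd]: the adjoint
    of the map of differences sends tuples of [Xd] to tuples of [Xd], so that
    this map is weakly continuous although [N] and [Np] are unrelated. *)
Lemma dual_adjoint (phi : normed N -> R) : dual (normed N) phi ->
  exists xs, [/\ forall i, Xd (xs i), phi = pairing xs &
    (fun u => phi (A u)) = pairing (adjoint xs)].
Proof.
rewrite dual_N => -[xs xsD <-]; exists xs; split=> //; apply/funext => u.
by rewrite (pairing_adjoint n_gt1)// => i; case: Xd_space => + _ _; apply.
Qed.

Lemma differences_bounded : is_complete (normed Np) ->
  exists2 L, 0 <= L & forall u : normed Np, N (A u) <= L * `|u|.
Proof.
move=> Np_complete.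
apply: (@complete_seminorm_bounded _ (normed Np) Np_complete (fun u => N (A u))
  [set f | exists phi : normed N -> R, [/\ scalar phi, forall w, phi w <= `|w| &
     f = fun u => phi (A u)]]).
- move=> _ [phi [phis phiN ->]].
  have phid : dual (normed N) phi.
    by apply: (@bounded_functional_dual _ _ 1); split=> // w; rewrite mul1r.
  have [xs [xsD _ ->]] := dual_adjoint phid.
  by rewrite dual_Np; exists (adjoint xs) => //; exact: adjoint_in.
- move=> _ u [phi [phis phiN ->]].
  have [_ phiN' _ _] := scalarE phis.
  rewrite ler_norml; have := phiN (A u); have := phiN (- (A u : normed N)).
  by rewrite phiN' normrN normE => *; apply/andP; split; lra.
- move=> u; have [phi [phis phiN phiu]] := norm_subgradient (A u : normed N).
  by exists (fun u => phi (A u)) => //; exists phi.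
Qed.

Lemma seminorm_convex : convexf (fun u : normed Np => N (A u)).
Proof.
move=> x y t t0 t1; rewrite differencesD !differencesZ.
by apply: le_trans (norm_onD _ _ _) _; rewrite !norm_onZ !ger0_norm ?subr_ge0.
Qed.

(** Being bounded above on the kernel of the map of differences, [l] factors as
    [phi o A].  Then [phi <= N] and [phi (A x) >= N (A x) - s], so that the norm
    [mu] of [phi] is between [1 - s / N (A x)] and [1], and [- phi / mu] is the
    tuple.  Dividing the normal functional by [mu] as well keeps it in the cone
    and leaves [psi / mu] as difference; the strict inequality between [c] and
    [E] absorbs [mu]. *)
Lemma functionals_of_subgradient (x : normed Np) (l psi : normed Np -> R)
    (c s E : R) (C : set (normed Np -> R)) :
  scalar l -> scalar psi ->
  (forall y, l y <= N (A (x + y)) - N (A x) + s) ->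
  (forall y, psi y <= c * `|y|) -> 0 <= c -> 0 <= s -> s < N (A x) ->
  c * N (A x) < E * (N (A x) - s) ->
  (forall t, 0 < t -> dual (normed Np) (fun y => - (t * (l y + psi y))) ->
     C (fun y => - (t * (l y + psi y)))) ->
  exists xs : 'I_n -> X -> R,
    [/\ forall i, Xd (xs i),
        \sum_i xs i = 0 /\
          dual_norm (normed N) (pairing (fun i => xs (init_idx i))) = 1,
        dual_dist (normed Np) (pairing xs) C < E &
        N (A x) - s <=
          \sum_(i < n.-1) xs (init_idx i) (x (last_idx n_gt1) - x (init_idx i))
          <= N (A x)].
Proof.
move=> ls ps lx pc c0 s0 sN cE CP.
have [l0 lN lD lZ] := scalarE ls.
pose phi (w : normed N) := l (pad w).
have phis : scalar phi by move=> a u v; rewrite /phi pad_linear ls.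
have [phi0 phiN phiD phiZ] := scalarE phis.
have large (a b : R) : (forall t, 0 < t -> t * a <= b) -> a <= 0.
  move=> h; rewrite leNgt; apply/negP => a0.
  have t0 : 0 < (`|b| + 1) / a by rewrite divr_gt0// ltr_wpDl.
  by have := h _ t0; rewrite divfK ?gt_eqF//; have := ler_norm b; lra.
have lker k : A k = 0 -> l k <= 0.
  move=> Ak; apply: (@large _ s) => t t0; rewrite -lZ; apply: le_trans (lx _) _.
  have -> : A (x + t *: k) = A x.
    by rewrite differencesD differencesZ Ak scaler0 addr0.
  by rewrite subrr add0r.
have lE u : l u = phi (A u).
  have kA : A (u - pad (A u)) = 0 by rewrite differencesB differences_pad subrr.
  have kA' : A (- (u - pad (A u))) = 0.
    by rewrite -sub0r differencesB kA subr0 differences0.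
  have := lker _ kA; have := lker _ kA'.
  by rewrite lN !lD lN /phi => *; lra.
have phix w : phi w <= N (A x + w) - N (A x) + s.
  by have := lx (pad w); rewrite differencesD differences_pad.
have phi_le w : phi w <= `|w|.
  rewrite -subr_le0; apply: (@large _ s) => t t0.
  have := phix (t *: w); rewrite phiZ normE.
  have := norm_onD N (A x) (t *: w); rewrite norm_onZ gtr0_norm//.
  by rewrite mulrBr; lra.
have phi_ge : N (A x) - s <= phi (A x).
  have := phix (- A x); rewrite phiN subrr -(scale0r 0) norm_onZ normr0 mul0r; lra.
have Nx0 : 0 < N (A x) by apply: le_lt_trans sN.
have phi_bd : bounded_functional 1 phi by split=> // w; rewrite mul1r.
have phid : dual (normed N) phi := bounded_functional_dual phi_bd.
pose mu := dual_norm (normed N) phi.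
have mu1 : mu <= 1.
  apply: dual_norm_le => // w; exact: (bounded_functional_norm w phi_bd).
have mu_ge : N (A x) - s <= mu * N (A x).
  apply: le_trans phi_ge _; apply: le_trans (ler_norm _) _; exact: dual_normP.
have mu0 : 0 < mu.
  by rewrite -(pmulr_lgt0 _ Nx0); apply: lt_le_trans mu_ge; rewrite subr_gt0.
pose phi' (w : normed N) := mu^-1 * phi (- w).
have phiNd : dual (normed N) (fun w => phi (- w)).
  apply: (@bounded_functional_dual _ _ 1); split=> [a u v|w].
    by rewrite !phiN phis; ring.
  by rewrite mul1r -normrN.
have phiNn : dual_norm (normed N) (fun w => phi (- w)) = mu.
  rewrite /mu /dual_norm; congr sup; apply/seteqP; split=> _ [w /= w1 <-].
    by exists (- w); rewrite //= normrN.
  by exists (- w); rewrite //= ?normrN ?opprK.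
have phi'd : dual (normed N) phi'.
  apply: (@bounded_functional_dual _ _ mu^-1); split=> [a u v|w].
    by rewrite /phi' (phiNd.1 a u v); ring.
  by rewrite /phi' ler_pM2l ?invr_gt0// -normrN.
have phi'n : dual_norm (normed N) phi' = 1.
  by rewrite dual_normZ ?invr_ge0 ?(ltW mu0)// phiNn mulVf// gt_eqF.
have [xs [xsD phi'E adjE]] := dual_adjoint phi'd.
have ld : dual (normed Np) l.
  have [ys [ysD _ yE]] := dual_adjoint phid.
  have -> : l = pairing (adjoint ys) by rewrite -yE; apply/funext.
  by rewrite dual_Np; exists (adjoint ys) => //; exact: adjoint_in.
have sum_dual t : 0 < t -> dual (normed Np) (fun y => - (t * (l y + psi y))).
  move=> t0; have [B B0 lB] := dual_bounded_functional ld.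
  apply: (@bounded_functional_dual _ _ (t * (B + c))); split=> [a u v|y].
    by rewrite ls ps; ring.
  have [_ pN _ _] := scalarE ps.
  rewrite -mulrN -mulrA ler_pM2l// opprD -lN -pN mulrDl -[`|y|]normrN.
  by rewrite lerD//; exact: lB.2.
exists (adjoint xs); split.
- exact: adjoint_in.
- split; first exact: sum_adjoint.
  rewrite -phi'n phi'E; congr dual_norm; congr pairing.
  by apply/funext => i; rewrite adjoint_init.
- have mi0 : 0 < mu^-1 by rewrite invr_gt0.
  have := @dual_dist_le R (normed Np) (pairing (adjoint xs)) _ _ (CP _ mi0 (sum_dual _ mi0)).
  move=> /le_lt_trans; apply.
  rewrite -adjE; apply: (@le_lt_trans _ _ (c / mu)).
    apply: dual_norm_le => [|y]; first by rewrite divr_ge0// ltW.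
    have [_ pN _ _] := scalarE ps.
    rewrite /= /phi' phiN -lE.
    have -> : mu^-1 * - l y - - (mu^-1 * (l y + psi y)) = mu^-1 * psi y by ring.
    rewrite normrM gtr0_norm ?invr_gt0// [c / mu]mulrC -mulrA ler_pM2l ?invr_gt0//.
    rewrite ler_norml pc andbT.
    by have := pc (- y); rewrite pN normrN; lra.
  rewrite ltr_pdivrMr// -(ltr_pM2r Nx0); apply: (lt_le_trans cE).
  rewrite -mulrA ler_wpM2l//.
  have : 0 < E * (N (A x) - s).
    by apply: le_lt_trans cE; rewrite mulr_ge0// ltW.
  by rewrite pmulr_lgt0 ?subr_gt0// => /ltW.
- have -> : \sum_(i < n.-1) adjoint xs (init_idx i) (x (last_idx n_gt1) - x (init_idx i)) =
      mu^-1 * phi (A x).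
    transitivity (phi' (- A x)); last by rewrite /phi' opprK.
    rewrite phi'E; apply: eq_bigr => i _; rewrite adjoint_init; congr (xs i _).
    by rewrite !ffunE opprB.
  rewrite mulrC; apply/andP; split.
    apply: (le_trans phi_ge); rewrite ler_pdivlMr// ler_piMr//.
    by apply: le_trans phi_ge; rewrite subr_ge0 ltW.
  rewrite ler_pdivrMr// mulrC; apply: le_trans (ler_norm _) _; exact: dual_normP.
Qed.

End Multipliers.

Theorem theorem3p1 (R : realType) (n : nat) (n_gt1 : (1 < n)%N)
    (X : lmodType R)
    (N : norm_on {ffun 'I_n.-1 -> X}) (Np : norm_on {ffun 'I_n -> X})
    (Np_complete : is_complete (normed Np))
    (Xd : set (X -> R)) (Xd_space : functional_space Xd)
    (dual_N : dual_is_power N Xd) (dual_Np : dual_is_power Np Xd)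
    (Omega : 'I_n -> set X) (Omega_neq0 : forall i, Omega i !=set0)
    (Omega_closed : closed (set_prod Omega : set (normed Np)))
    (omega : {ffun 'I_n -> X}) (omega_in : set_prod Omega omega)
    (eps delta : R) (eps_gt0 : 0 < eps) (delta_gt0 : 0 < delta)
    (Omega_disj : \bigcap_i Omega i = set0)
    (omega_inf :
      N [ffun i => omega (init_idx i) - omega (last_idx n_gt1)]
      < inf [set N [ffun i => u (init_idx i) - u (last_idx n_gt1)]
              | u in set_prod Omega] + eps) :
  (exists (x : {ffun 'I_n -> X}) (xs : 'I_n -> X -> R),
    [/\ set_prod Omega x /\ ball (omega : normed Np) delta x,
        forall i, Xd (xs i),
        \sum_i xs i = 0 /\
          dual_norm (normed N) (pairing (fun i => xs (init_idx i))) = 1,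
        dual_dist (normed Np) (pairing xs)
          (clarke_normal_cone (normed Np) (set_prod Omega) x)
          < eps / delta &
        \sum_(i < n.-1) xs (init_idx i) (x (last_idx n_gt1) - x (init_idx i))
          = N [ffun i => x (last_idx n_gt1) - x (init_idx i)]])
  /\
  (asplund (normed Np) ->
   (exists2 kappa : R, 0 < kappa & forall u : {ffun 'I_n -> X},
      Num.max (N [ffun i => u (init_idx i)]) (N [ffun=> u (last_idx n_gt1)])
        <= kappa * Np u) ->
   forall tau : R, 0 < tau < 1 ->
   exists (x : {ffun 'I_n -> X}) (xs : 'I_n -> X -> R),
    [/\ set_prod Omega x /\ ball (omega : normed Np) delta x,
        forall i, Xd (xs i),
        \sum_i xs i = 0 /\
          dual_norm (normed N) (pairing (fun i => xs (init_idx i))) = 1,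
        dual_dist (normed Np) (pairing xs)
          (frechet_normal_cone (normed Np) (set_prod Omega) x)
          < eps / delta &
        \sum_(i < n.-1) xs (init_idx i) (x (last_idx n_gt1) - x (init_idx i))
          > tau * N [ffun i => x (last_idx n_gt1) - x (init_idx i)]]).
Proof.
pose A := @differences R n n_gt1 X.
pose Om : set (normed Np) := set_prod Omega.
pose f (u : normed Np) := N (A u).
have N_ge0 w : 0 <= N w by exact: (@normr_ge0 _ (normed N) w).
have fE (u : {ffun 'I_n -> X}) : N [ffun i => u (last_idx n_gt1) - u (init_idx i)] = f u.
  have -> : [ffun i => u (last_idx n_gt1) - u (init_idx i)] = - A u.
    by apply/ffunP => i; rewrite !ffunE opprB.
  exact: (@normrN _ (normed N)).
have [L L0 fL'] := differences_bounded n_gt1 Xd_space dual_N dual_Np Np_complete.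
have fL (x y : normed Np) : f y <= f x + L * `|y - x|.
  rewrite /f -{1}(subrKC x y) /A differencesD.
  by apply: le_trans (norm_onD _ _ _) _; rewrite lerD2l.
have fc : convexf f by exact: seminorm_convex.
have f_gt0 u : Om u -> 0 < f u.
  move=> Ou; rewrite lt_neqAle N_ge0 andbT eq_sym; apply/eqP => /norm_on0 Au.
  suff : (\bigcap_i Omega i) (u (last_idx n_gt1)) by rewrite Omega_disj.
  move=> i _; have [iE|iE] := eqVneq i (last_idx n_gt1); first by rewrite -iE; exact: Ou.
  have ilt : (i < n.-1)%N.
    rewrite ltn_neqAle; apply/andP; split; first by rewrite -val_eqE in iE.
    by rewrite -ltnS (ltn_predK n_gt1).
  have := congr1 (fun w : {ffun 'I_n.-1 -> X} => w (Ordinal ilt)) Au.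
  rewrite !ffunE => /eqP.
  rewrite subr_eq0 => /eqP <-.
  by have -> : init_idx (Ordinal ilt) = i by exact: val_inj.
pose I := inf [set f u | u in Om].
have If u : Om u -> I <= f u.
  move=> Ou; apply: ge_inf; last by exists u.
  by exists 0 => _ [v _ <-]; exact: N_ge0.
have [x1 [c [Ox1 x1d c0 cE x1min]]] := ekeland Np_complete Omega_closed omega_in L0
  eps_gt0 delta_gt0 fL If omega_inf.
have E0 : 0 < eps / delta by rewrite divr_gt0.
have Nx1 := f_gt0 _ Ox1.
split.
  pose G := [set a : normed Np * R | clarke_tangent_cone (normed Np) Om x1 a.1 /\ a.2 = 0].
  have [||||l [psi [ls ps lx pc lG]]] :=
    @subgradient_splitting _ _ f L c 0 x1 G fc fL c0 (lexx 0).
  - by split=> //; exact: clarke_tangent_cone0.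
  - move=> [a1 a2] [b1 b2] [/= Ta ->] [/= Tb ->]; split=> /=; last by rewrite addr0.
    exact: clarke_tangent_coneD.
  - move=> t [a1 a2] t0 [/= Ta ->]; split=> /=; last by rewrite mulr0.
    exact: clarke_tangent_coneZ.
  - move=> [a1 a2] [/= Ta ->]; rewrite !addr0.
    exact: (clarke_minimum Ox1 fc L0 c0 fL x1min Ta).
  have := @functionals_of_subgradient R n n_gt1 X N Np Xd Xd_space dual_N dual_Np
    x1 l psi c 0 (eps / delta) (clarke_normal_cone (normed Np) Om x1) ls ps lx pc c0 (lexx 0) Nx1.
  rewrite subr0 ltr_pM2r// => /(_ cE) [t t0 gd|xs [xsD xs0 xsd xsN]].
    split=> //.
    move=> z Tz; rewrite oppr_le0 mulr_ge0 ?(ltW t0)//.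
    by have := lG (z, 0) (conj Tz erefl); rewrite /= addr0.
  exists x1, xs; split=> //.
    by split=> //; rewrite -ball_normE /= distrC.
  by rewrite fE; apply/eqP; rewrite eq_le andbC.
move=> asp _ tau /andP[tau0 tau1].
set E := eps / delta in cE E0 *; clearbody E.
pose c0' := (E - c) / 4; have c0'0 : 0 < c0' by rewrite divr_gt0// subr_gt0.
pose c' := c + 2 * c0'.
have c'0 : 0 <= c' by apply: addr_ge0 => //; apply: mulr_ge0 => //; exact: ltW.
have c'E : c' < E by rewrite /c' /c0'; lra.
have dpos : 0 < delta - `|x1 - omega : normed Np| by rewrite subr_gt0.
(* The approximation error [s] has to be small compared with [f v], and [v] depends
   on [s]: the bound [s3] keeps [v] so close to [x1] that [f v >= f x1 / 2]. The
   bound [s1] takes care of [tau], [s2] of the distance and [s4] of the ball. *)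
have [s [s0 s1 s2 s3 s4]] : exists s, [/\ 0 < s, s <= (1 - tau) * f x1 / 4,
    s <= (E - c') * f x1 / (4 * E), s <= c0' * f x1 / (12 * (L + 1)) &
    s <= c0' * (delta - `|x1 - omega : normed Np|) / 12].
  have p1 : 0 < (1 - tau) * f x1 / 4 by rewrite divr_gt0// mulr_gt0// subr_gt0.
  have p2 : 0 < (E - c') * f x1 / (4 * E) by rewrite divr_gt0// mulr_gt0// subr_gt0.
  have p3 : 0 < c0' * f x1 / (12 * (L + 1)).
    by rewrite divr_gt0// mulr_gt0// ltr_wpDl.
  have p4 : 0 < c0' * (delta - `|x1 - omega : normed Np|) / 12.
    by rewrite divr_gt0// mulr_gt0.
  move: p1 p2 p3 p4; set a := _ / 4; set b := _ / (4 * E); set d := _ / (12 * _).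
  set k := _ / 12 => p1 p2 p3 p4; exists (Num.min (Num.min a b) (Num.min d k)).
  by split; rewrite ?lt_min ?p1 ?p2 ?p3 ?p4// !ge_min lexx ?orbT.
have [v [l [psi [Ov vx [ls ps] [lx pc] fn]]]] := asplund_fuzzy Np_complete asp Omega_closed
  Ox1 L0 c0 s0 c0'0 fc fL x1min.
have rho_d : `|v - x1| < delta - `|x1 - omega : normed Np|.
  apply: le_lt_trans vx _; move: s4; rewrite mulrA ltr_pdivrMr//.
  by move: dpos c0'0; set d := delta - _; nra.
have fv : f x1 / 2 <= f v.
  have := fL v x1; rewrite distrC => h.
  have h2 : L * `|v - x1| <= f x1 / 2.
    have L1 : 0 < L + 1 by rewrite ltr_wpDl.
    apply: le_trans (ler_wpM2l L0 vx) _; rewrite mulrA mulrA ler_pdivrMr//.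
    move: s3; rewrite ler_pdivlMr ?mulr_gt0// => s3.
    by have : 0 <= s := ltW s0; nra.
  by lra.
have sv : s < (1 - tau) * f v.
  have t1 : 0 < 1 - tau by rewrite subr_gt0.
  by have := ler_wpM2l (ltW t1) fv; have := mulr_gt0 t1 Nx1; lra.
have sfv : s < f v.
  apply: lt_le_trans sv _; rewrite ler_piMl ?N_ge0//; lra.
have cfv : c' * f v < E * (f v - s).
  have e1 : 0 < E - c' by rewrite subr_gt0.
  have : s * E <= (E - c') * f x1 / 4.
    by rewrite ler_pdivlMr ?mulr_gt0// in s2; lra.
  by have := ler_wpM2l (ltW e1) fv; have := mulr_gt0 e1 Nx1; lra.
have [t t0 gd|xs [xsD xs0 xsd /andP[xsN _]]] := @functionals_of_subgradient R n n_gt1 X N Np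
    Xd Xd_space dual_N dual_Np v l psi c' s E (frechet_normal_cone (normed Np) Om v)
    ls ps lx pc c'0 (ltW s0) sfv cfv.
  apply: frechet_normal_coneI => // e e0.
  have [r r0 h] := fn _ (divr_gt0 e0 t0); exists r => // u Ou ur.
  have := h u Ou ur; rewrite -(ler_pM2l t0).
  have -> : t * - (e / t * `|u - v|) = - (e * `|u - v|) by field; rewrite gt_eqF.
  by rewrite lerNl.
exists v, xs; split=> //.
  split=> //; rewrite -ball_normE /= distrC -(subrKA x1).
  by apply: le_lt_trans (ler_normD _ _) _; lra.
rewrite fE; apply: lt_le_trans xsN; rewrite -/(f v); lra.
Qed.
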